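(* $\mathsf{BIM}\vdash\mathbf{\Pi}^1_1$-$\mathbf{BI}\rightarrow\mathbf{AlmFT}$, where $\mathbf{\Pi}^1_1$-$\mathbf{BI}$: for every $\beta$, if $CA_\beta$ is a bar in $\mathcal N$ and $\forall s[s\in CA_\beta\leftrightarrow\forall i[s\ast\langle i\rangle\in CA_\beta]]$, then $\langle\rangle\in CA_\beta$; $\mathbf{AlmFT}$: for all $\beta,\alpha$, if $Almfan(\beta)$, $D_\alpha$ is a thin bar in $\mathcal F_\beta$, and $\forall s[s\in D_\alpha\rightarrow\beta(s)=0]$, then $D_\alpha$ is almost-finite.
   Context: $\mathsf{BIM}$ is the two-sorted formal theory with intuitionistic logic of natural numbers and functions $\mathbb N\to\mathbb N$ (Baire space $\mathcal N$), with extensionality, primitive recursive constants including a pairing $(m,n)$, closure of functions under composition, primitive recursion and unbounded search, and full induction. Finite sequences are coded by naturals ($\langle\rangle$ empty, $s\ast\langle i\rangle$ appending, $\overline\gamma n=\langle\gamma(0),\dots,\gamma(n-1)\rangle$, $s\sqsubseteq t$ initial part). $D_\alpha=\{n\mid\alpha(n)\ne0\}$. $CA_\beta=\{s\mid\forall\gamma\exists n[\beta((s,\overline\gamma n))\ne0]\}$. $[\omega]^\omega$ is the set of strictly increasing $\zeta:\mathbb N\to\mathbb N$; $X\subseteq\mathbb N$ is almost-finite if $\forall\zeta\in[\omega]^\omega\exists n[\zeta(n)\notin X]$. $\mathcal F_\beta=\{\alpha\mid\forall n[\beta(\overline\alpha n)=0]\}$; $\beta$ is a spread-law if $\forall s[\beta(s)=0\leftrightarrow\exists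 n[\beta(s\ast\langle n\rangle)=0]]$; $Almfan(\beta)$ means $\beta$ is a spread-law and $\forall s\forall\zeta\in[\omega]^\omega\exists n[\beta(s\ast\langle\zeta(n)\rangle)\ne0]$. $B$ is a bar in a set $\mathcal X\subseteq\mathcal N$ if $\forall\gamma\in\mathcal X\exists n[\overline\gamma n\in B]$, and a thin bar if moreover $s,t\in B$, $s\sqsubseteq t$ imply $s=t$. *)

(* Defs.v *)
From Stdlib Require Import List.
From Stdlib Require Vector Fin.

Set Implicit Arguments.
Unset Strict Implicit.
Unset Printing Implicit Defensive.

(** The statement is about derivability in the formal theory BIM, so the
    syntax of BIM and its (intuitionistic) deduction relation are formalized
    explicitly; nothing is inherited from the logic of Rocq. *)

(* [prf k]: definitions of k-ary primitive recursive functions, each serving as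
   a function constant; [PRec] recurses on its first argument. *)
Inductive prf : nat -> Type :=
| PZero : prf 0
| PSucc : prf 1
| PProj (n : nat) (i : Fin.t n) : prf n
| PComp (m n : nat) (g : prf m) (hs : Vector.t (prf n) m) : prf n
| PRec (n : nat) (g : prf n) (h : prf (S (S n))) : prf (S n).

Section Pairing.
Import Vector.VectorNotations.
Local Open Scope vector_scope.

Definition pr_add : prf 2 :=
  PRec (PProj Fin.F1) (PComp PSucc [PProj (Fin.FS Fin.F1)]).

(* pr_tri (n) = 0 + 1 + ... + n *)
Definition pr_tri : prf 1 :=
  PRec PZero (PComp pr_add [PComp PSucc [PProj Fin.F1]; PProj (Fin.FS Fin.F1)]).

(* Cantor's bijection (m, n) |-> (0 + 1 + ... + (m + n)) + n *)
Definition pr_pair : prf 2 :=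
  PComp pr_add [PComp pr_tri [pr_add]; PProj (Fin.FS Fin.F1)].
End Pairing.

(** De Bruijn indices, counted separately for the sort of numbers ([NVar],
    [AllN], [ExN]) and the sort of functions ([FVar], [AllF], [ExF]). *)

Inductive fterm : Type :=
| FVar (i : nat)
| FPr (f : prf 1).

Inductive nterm : Type :=
| NVar (i : nat)
| NApp (a : fterm) (t : nterm)
| NPr (k : nat) (f : prf k) (ts : Vector.t nterm k).

Inductive form : Type :=
| EqN (s t : nterm)
| EqF (a b : fterm)
| Bot
| And (p q : form)
| Or (p q : form)
| Imp (p q : form)
| AllN (p : form)
| ExN (p : form)
| AllF (p : form)
| ExF (p : form).

Definition Iff (p q : form) : form := And (Imp p q) (Imp q p).

Definition zero : nterm := NPr PZero (Vector.nil _).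
Definition succ (t : nterm) : nterm := NPr PSucc (Vector.cons _ t _ (Vector.nil _)).
Definition add (s t : nterm) : nterm :=
  NPr pr_add (Vector.cons _ s _ (Vector.cons _ t _ (Vector.nil _))).
Definition pair (s t : nterm) : nterm :=
  NPr pr_pair (Vector.cons _ s _ (Vector.cons _ t _ (Vector.nil _))).

Definition scons (T : Type) (x : T) (s : nat -> T) (i : nat) : T :=
  match i with 0 => x | S j => s j end.

Definition subst_f (sf : nat -> fterm) (a : fterm) : fterm :=
  match a with FVar i => sf i | FPr f => FPr f end.

Fixpoint subst_n (sn : nat -> nterm) (sf : nat -> fterm) (t : nterm) : nterm :=
  match t with
  | NVar i => sn i
  | NApp a u => NApp (subst_f sf a) (subst_n sn sf u)
  | NPr f ts => NPr f (Vector.map (subst_n sn sf) ts)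
  end.

Definition shiftN (i : nat) : nterm := NVar (S i).
Definition shiftF (i : nat) : fterm := FVar (S i).

(* Only number terms contain variables of both sorts, so crossing a function
   quantifier renames inside both substitutions, and crossing a number
   quantifier inside the first one only. *)
Fixpoint subst (sn : nat -> nterm) (sf : nat -> fterm) (p : form) : form :=
  let upN := scons (NVar 0) (fun i => subst_n shiftN FVar (sn i)) in
  let upF := scons (FVar 0) (fun i => subst_f shiftF (sf i)) in
  let liftF := fun i => subst_n NVar shiftF (sn i) in
  match p with
  | EqN s t => EqN (subst_n sn sf s) (subst_n sn sf t)
  | EqF a b => EqF (subst_f sf a) (subst_f sf b)
  | Bot => Bot
  | And p q => And (subst sn sf p) (subst sn sf q)
  | Or p q => Or (subst sn sf p) (subst sn sf q)
  | Imp p q => Imp (subst sn sf p) (subst sn sf q)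
  | AllN p => AllN (subst upN sf p)
  | ExN p => ExN (subst upN sf p)
  | AllF p => AllF (subst liftF upF p)
  | ExF p => ExF (subst liftF upF p)
  end.

Definition instN (t : nterm) (p : form) : form := subst (scons t NVar) FVar p.
Definition instF (a : fterm) (p : form) : form := subst NVar (scons a FVar) p.
Definition weakN (p : form) : form := subst shiftN FVar p.
Definition weakF (p : form) : form := subst NVar shiftF p.

(** Closed formulas are written with Rocq functions as binders. An expression is a function of the numbers [d], [e] of enclosing number
    and function quantifiers. The variable bound by the quantifier at depth
    [d] has index [d' - S d] when it is used at depth [d']; hence expressions
    can be moved under further quantifiers without explicit renaming. *)

Definition nexp : Type := nat -> nat -> nterm.
Definition fexp : Type := nat -> fterm.
Definition fexpr : Type := nat -> nat -> form.

Definition all0 (P : nexp -> fexpr) : fexpr :=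
  fun d e => AllN (P (fun d' _ => NVar (d' - S d)) (S d) e).
Definition ex0 (P : nexp -> fexpr) : fexpr :=
  fun d e => ExN (P (fun d' _ => NVar (d' - S d)) (S d) e).
Definition all1 (P : fexp -> fexpr) : fexpr :=
  fun d e => AllF (P (fun e' => FVar (e' - S e)) d (S e)).
Definition ex1 (P : fexp -> fexpr) : fexpr :=
  fun d e => ExF (P (fun e' => FVar (e' - S e)) d (S e)).

Definition sentence (P : fexpr) : form := P 0 0.

Definition O' : nexp := fun _ _ => zero.
Definition S' (x : nexp) : nexp := fun d e => succ (x d e).
Definition add' (x y : nexp) : nexp := fun d e => add (x d e) (y d e).
Definition pair' (x y : nexp) : nexp := fun d e => pair (x d e) (y d e).
Definition ap (a : fexp) (x : nexp) : nexp := fun d e => NApp (a e) (x d e).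
Definition eq1 (a b : fexp) : fexpr := fun _ e => EqF (a e) (b e).

Declare Scope bim_scope.
Delimit Scope bim_scope with bim.
Bind Scope bim_scope with fexpr.

Notation "x = y" := (fun d e => EqN (x d e) (y d e)) : bim_scope.
Notation "x <> y" := (fun d e => Imp (EqN (x d e) (y d e)) Bot) : bim_scope.
Notation "P /\ Q" := (fun d e => And (P%bim d e) (Q%bim d e)) : bim_scope.
Notation "P -> Q" := (fun d e => Imp (P%bim d e) (Q%bim d e)) : bim_scope.
Notation "P <-> Q" := (fun d e => Iff (P%bim d e) (Q%bim d e)) : bim_scope.
Notation "~ P" := (fun d e => Imp (P%bim d e) Bot) : bim_scope.

Definition ax_extensionality : form := sentence
  (all1 (fun a => all1 (fun b =>
    eq1 a b <-> all0 (fun n => ap a n = ap b n))))%bim.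

Definition ax_succ_neq0 : form := sentence
  (all0 (fun n => S' n <> O'))%bim.

Definition ax_succ_inj : form := sentence
  (all0 (fun m => all0 (fun n => S' m = S' n -> m = n)))%bim.

Definition ax_composition : form := sentence
  (all1 (fun a => all1 (fun b => ex1 (fun c =>
    all0 (fun n => ap c n = ap a (ap b n))))))%bim.

Definition ax_recursion : form := sentence
  (all1 (fun a => all1 (fun b => ex1 (fun c => all0 (fun m => all0 (fun n =>
    ap c (pair' m O') = ap a m /\
    ap c (pair' m (S' n)) = ap b (pair' (pair' m n) (ap c (pair' m n)))))))))%bim.

Definition ax_search : form := sentence
  (all1 (fun a =>
    all0 (fun m => ex0 (fun n => ap a (pair' m n) = O')) ->
    ex1 (fun c => all0 (fun m => ap a (pair' m (ap c m)) = O'))))%bim.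

(* [ax_search] does not require the least witness: least witnesses are then
   definable. Schemes may have free variables (parameters); their universal closures
   follow by generalization. *)
Inductive BIM_axiom : form -> Prop :=
| Ax_extensionality : BIM_axiom ax_extensionality
| Ax_succ_neq0 : BIM_axiom ax_succ_neq0
| Ax_succ_inj : BIM_axiom ax_succ_inj
| Ax_proj (n : nat) (i : Fin.t n) (ts : Vector.t nterm n) :
    BIM_axiom (EqN (NPr (PProj i) ts) (Vector.nth ts i))
| Ax_comp (m n : nat) (g : prf m) (hs : Vector.t (prf n) m)
    (ts : Vector.t nterm n) :
    BIM_axiom (EqN (NPr (PComp g hs) ts)
                   (NPr g (Vector.map (fun h => NPr h ts) hs)))
| Ax_rec0 (n : nat) (g : prf n) (h : prf (S (S n))) (ts : Vector.t nterm n) :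
    BIM_axiom (EqN (NPr (PRec g h) (Vector.cons _ zero _ ts)) (NPr g ts))
| Ax_recS (n : nat) (g : prf n) (h : prf (S (S n))) (t : nterm)
    (ts : Vector.t nterm n) :
    BIM_axiom (EqN (NPr (PRec g h) (Vector.cons _ (succ t) _ ts))
                   (NPr h (Vector.cons _ t _
                     (Vector.cons _ (NPr (PRec g h) (Vector.cons _ t _ ts)) _ ts))))
| Ax_const (f : prf 1) (t : nterm) :
    BIM_axiom (EqN (NApp (FPr f) t) (NPr f (Vector.cons _ t _ (Vector.nil _))))
| Ax_composition : BIM_axiom ax_composition
| Ax_recursion : BIM_axiom ax_recursion
| Ax_search : BIM_axiom ax_search
| Ax_induction (p : form) :
    BIM_axiom
      (Imp (And (instN zero p)
                (AllN (Imp p (subst (scons (succ (NVar 0)) shiftN) FVar p))))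
           (AllN p)).

Inductive prv : list form -> form -> Prop :=
| R_hyp G p : List.In p G -> prv G p
| R_ax G p : BIM_axiom p -> prv G p
| R_botE G p : prv G Bot -> prv G p
| R_andI G p q : prv G p -> prv G q -> prv G (And p q)
| R_andE1 G p q : prv G (And p q) -> prv G p
| R_andE2 G p q : prv G (And p q) -> prv G q
| R_orI1 G p q : prv G p -> prv G (Or p q)
| R_orI2 G p q : prv G q -> prv G (Or p q)
| R_orE G p q r :
    prv G (Or p q) -> prv (p :: G) r -> prv (q :: G) r -> prv G r
| R_impI G p q : prv (p :: G) q -> prv G (Imp p q)
| R_impE G p q : prv G (Imp p q) -> prv G p -> prv G q
| R_allNI G p : prv (List.map weakN G) p -> prv G (AllN p)
| R_allNE G p t : prv G (AllN p) -> prv G (instN t p)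
| R_exNI G p t : prv G (instN t p) -> prv G (ExN p)
| R_exNE G p q :
    prv G (ExN p) -> prv (p :: List.map weakN G) (weakN q) -> prv G q
| R_allFI G p : prv (List.map weakF G) p -> prv G (AllF p)
| R_allFE G p a : prv G (AllF p) -> prv G (instF a p)
| R_exFI G p a : prv G (instF a p) -> prv G (ExF p)
| R_exFE G p q :
    prv G (ExF p) -> prv (p :: List.map weakF G) (weakF q) -> prv G q
| R_eqN_refl G t : prv G (EqN t t)
| R_eqN_subst G s t p : prv G (EqN s t) -> prv G (instN s p) -> prv G (instN t p)
| R_eqF_refl G a : prv G (EqF a a)
| R_eqF_subst G a b p : prv G (EqF a b) -> prv G (instF a p) -> prv G (instF b p).

Definition BIM_proves (p : form) : Prop := prv nil p.

Section Notions.
Local Open Scope bim_scope.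

Definition less (x y : nexp) : fexpr := ex0 (fun k => add' x (S' k) = y).

(* Finite sequences are coded by <> := 0 and s * <i> := S (s, i); this is a
   bijection between finite sequences and natural numbers. *)
Definition emptyseq : nexp := O'.
Definition snoc (s i : nexp) : nexp := S' (pair' s i).

(* t = s * <g(0), ..., g(n-1)>: t is the value at n of the function c
   defined by recursion from c(0) = s and c(i+1) = c(i) * <g(i)>. *)
Definition is_cat (s : nexp) (g : fexp) (n t : nexp) : fexpr :=
  ex1 (fun c =>
    ap c O' = s /\
    all0 (fun i => ap c (S' i) = snoc (ap c i) (ap g i)) /\
    ap c n = t).

(* t is the code of the initial part <g(0), ..., g(n-1)> of g; an atomic
   statement about this code is rendered as "exists t, is_init g n t /\ ..." *)
Definition is_init (g : fexp) (n t : nexp) : fexpr := is_cat emptyseq g n t.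

Definition initial_part (s t : nexp) : fexpr :=
  ex1 (fun g => ex0 (fun n => is_cat s g n t)).

Definition in_D (a : fexp) (n : nexp) : fexpr := ap a n <> O'.

Definition in_CA (b : fexp) (s : nexp) : fexpr :=
  all1 (fun g => ex0 (fun n => ex0 (fun t =>
    is_init g n t /\ ap b (pair' s t) <> O'))).

Definition in_F (b a : fexp) : fexpr :=
  all0 (fun n => ex0 (fun t => is_init a n t /\ ap b t = O')).

Definition increasing (z : fexp) : fexpr :=
  all0 (fun n => less (ap z n) (ap z (S' n))).

Definition almost_finite (X : nexp -> fexpr) : fexpr :=
  all1 (fun z => increasing z -> ex0 (fun n => ~ X (ap z n))).

Definition spread_law (b : fexp) : fexpr :=
  all0 (fun s => ap b s = O' <-> ex0 (fun n => ap b (snoc s n) = O')).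

Definition almfan (b : fexp) : fexpr :=
  spread_law b /\
  all0 (fun s => all1 (fun z => increasing z ->
    ex0 (fun n => ap b (snoc s (ap z n)) <> O'))).

Definition bar_at (B : nexp -> fexpr) (g : fexp) : fexpr :=
  ex0 (fun n => ex0 (fun t => is_init g n t /\ B t)).

Definition bar_in_Baire (B : nexp -> fexpr) : fexpr :=
  all1 (fun g => bar_at B g).

Definition bar_in (X : fexp -> fexpr) (B : nexp -> fexpr) : fexpr :=
  all1 (fun g => X g -> bar_at B g).

Definition thin_bar_in (X : fexp -> fexpr) (B : nexp -> fexpr) : fexpr :=
  bar_in X B /\
  all0 (fun s => all0 (fun t => (B s /\ B t) /\ initial_part s t -> s = t)).

Definition Pi11_BI : form := sentence
  (all1 (fun b =>
    bar_in_Baire (in_CA b) /\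
    all0 (fun s => in_CA b s <-> all0 (fun i => in_CA b (snoc s i))) ->
    in_CA b emptyseq)).

Definition AlmFT : form := sentence
  (all1 (fun b => all1 (fun a =>
    (almfan b /\ thin_bar_in (in_F b) (in_D a)) /\
    all0 (fun s => in_D a s -> ap b s = O') ->
    almost_finite (in_D a)))).

End Notions.

(* Main.v *)
Require Import Defs.
From Stdlib Require Import Arith List Lia Setoid Morphisms.
From Stdlib Require Vector.

Set Implicit Arguments.
Unset Strict Implicit.
Unset Printing Implicit Defensive.

(** For [AlmFT], apply bar induction to the nodes [s] such that the members of the
    bar extending [s] are almost-finite; "[X] is almost-finite" is taken in the
    form "for every [g] there is [n] with [n + g n] not in [X]", which involves no
    increasing sequences. Every [g] meets such a node: retract [g] onto the
    spread, where the bar provides a member of the bar, whose only extension in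
    the bar is itself. If all [s * <i>] have the property, then by induction on
    [m] every [g] has a value outside [X] or extending some [s * <i>] with
    [i >= m]; iterating this gives an increasing sequence of such [i], of which
    [Almfan] excludes one.

    Derivations in BIM are obtained from a shallow embedding: a formula is read as
    the predicate "derivable from [G]" on contexts [G], quantifiers becoming
    quantifiers of Rocq over open terms. This reading is exact because
    derivability of all instances entails derivability of the universal formula
    (take a fresh variable). *)

(** * Substitution *)

(** Bar induction is available only for sets [CA_c], whose matrix is a value of a single function,
    and the search axiom gives choice only for relations decided by a function. Both dictate the
    form of almost-finiteness. The increasing sequence [z] is fixed before the induction and enters
    [c] as a parameter. For each [n], [g] supplies not only an index of [z] but also the number of
    entries by which that term should extend [s], so that success is a quantifier-free condition. As
    [CA_c] sees [g] only through codes of initial parts, [n] has to be read back from a code, as a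
    length.

    Function terms of BIM are variables and constants, without abstraction, so each function used
    must be proved to exist; the axioms of composition, recursion and search concern unary
    functions, and already a term calling two functions needs an argument. Likewise induction and
    replacement of equals apply only to predicates given by a formula, so each use of them in the
    embedding carries a definability obligation. *)

Lemma nterm_nested_ind (P : nterm -> Prop) :
  (forall i, P (NVar i)) ->
  (forall a t, P t -> P (NApp a t)) ->
  (forall k (f : prf k) ts, Vector.Forall P ts -> P (NPr f ts)) ->
  forall t, P t.
Proof.
  intros HV HA HP. fix IH 1. intros [i|a t|k f ts].
  - apply HV.
  - apply HA, IH.
  - apply HP. clear f. induction ts as [|t n ts IHts]; [constructor|].
    constructor; [apply IH|exact IHts].
Qed.

Lemma subst_f_comp sf tf a :
  subst_f sf (subst_f tf a) = subst_f (fun i => subst_f sf (tf i)) a.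
Proof. now destruct a. Qed.

Lemma subst_n_comp sn sf tn tf t :
  subst_n sn sf (subst_n tn tf t) =
  subst_n (fun i => subst_n sn sf (tn i)) (fun i => subst_f sf (tf i)) t.
Proof.
  induction t as [i|a t IH|k f ts IH] using nterm_nested_ind; cbn.
  - reflexivity.
  - now rewrite subst_f_comp, IH.
  - f_equal. clear f. induction IH as [|n t ts Ht _ IH]; cbn; [reflexivity|now rewrite Ht, IH].
Qed.

(** [N] bounds the free variables of both sorts without defining them: any index not below [N] is
    fresh. Extensionality of substitution follows, so functional extensionality is avoided. *)
Lemma subst_n_agree t : exists N, forall sn sf sn' sf',
  (forall i, i < N -> sn i = sn' i /\ sf i = sf' i) ->
  subst_n sn sf t = subst_n sn' sf' t.
Proof.
  induction t as [i|a t [N IH]|k f ts IH] using nterm_nested_ind.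
  - exists (S i). intros sn sf sn' sf' H. apply H. lia.
  - exists (N + match a with FVar i => S i | _ => 0 end).
    intros sn sf sn' sf' H. cbn. f_equal.
    + destruct a as [i|f]; cbn; [apply H; lia|reflexivity].
    + apply IH. intros i Hi. apply H. lia.
  - assert (E : exists N, forall sn sf sn' sf',
      (forall i, i < N -> sn i = sn' i /\ sf i = sf' i) ->
      Vector.map (subst_n sn sf) ts = Vector.map (subst_n sn' sf') ts).
    { clear f. induction IH as [|n t ts [N Ht] _ [M IH]].
      - now exists 0.
      - exists (N + M). intros sn sf sn' sf' H. cbn. f_equal.
        + apply Ht. intros i Hi. apply H. lia.
        + apply IH. intros i Hi. apply H. lia. }
    destruct E as [N E]. exists N. intros sn sf sn' sf' H. cbn. f_equal. now apply E.
Qed.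

Lemma subst_n_ext sn sf sn' sf' t :
  (forall i, sn i = sn' i) -> (forall i, sf i = sf' i) ->
  subst_n sn sf t = subst_n sn' sf' t.
Proof. intros Hn Hf. destruct (subst_n_agree t) as [N H]. apply H. auto. Qed.

Lemma subst_n_id t : subst_n NVar FVar t = t.
Proof.
  induction t as [i|a t IH|k f ts IH] using nterm_nested_ind; cbn.
  - reflexivity.
  - rewrite IH. now destruct a.
  - f_equal. clear f. induction IH as [|n t ts Ht _ IH]; cbn; [reflexivity|now rewrite Ht, IH].
Qed.

Lemma subst_agree p : exists N, forall sn sf sn' sf',
  (forall i, i < N -> sn i = sn' i /\ sf i = sf' i) ->
  subst sn sf p = subst sn' sf' p.
Proof.
  induction p as [s t|a b| |p [N IHp] q [M IHq]|p [N IHp] q [M IHq]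
                 |p [N IHp] q [M IHq]|p [N IH]|p [N IH]|p [N IH]|p [N IH]].
  - destruct (subst_n_agree s) as [N Hs], (subst_n_agree t) as [M Ht].
    exists (N + M). intros sn sf sn' sf' H. cbn.
    f_equal; [apply Hs|apply Ht]; intros i Hi; apply H; lia.
  - exists (match a with FVar i => S i | _ => 0 end + match b with FVar i => S i | _ => 0 end).
    intros sn sf sn' sf' H. cbn.
    f_equal; [destruct a|destruct b]; cbn; try reflexivity; apply H; lia.
  - now exists 0.
  - exists (N + M). intros sn sf sn' sf' H. cbn.
    f_equal; [apply IHp|apply IHq]; intros i Hi; apply H; lia.
  - exists (N + M). intros sn sf sn' sf' H. cbn.
    f_equal; [apply IHp|apply IHq]; intros i Hi; apply H; lia.
  - exists (N + M). intros sn sf sn' sf' H. cbn.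
    f_equal; [apply IHp|apply IHq]; intros i Hi; apply H; lia.
  - exists N. intros sn sf sn' sf' H. cbn. f_equal. apply IH. intros [|i] Hi; cbn.
    + split; [reflexivity|now apply H].
    + destruct (H i) as [Hn _]; [lia|]. destruct (H (S i)) as [_ Hf]; [lia|].
      now rewrite Hn, Hf.
  - exists N. intros sn sf sn' sf' H. cbn. f_equal. apply IH. intros [|i] Hi; cbn.
    + split; [reflexivity|now apply H].
    + destruct (H i) as [Hn _]; [lia|]. destruct (H (S i)) as [_ Hf]; [lia|].
      now rewrite Hn, Hf.
  - exists N. intros sn sf sn' sf' H. cbn. f_equal. apply IH. intros [|i] Hi; cbn.
    + destruct (H 0) as [Hn _]; [lia|]. now rewrite Hn.
    + destruct (H (S i)) as [Hn _]; [lia|]. destruct (H i) as [_ Hf]; [lia|].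
      now rewrite Hn, Hf.
  - exists N. intros sn sf sn' sf' H. cbn. f_equal. apply IH. intros [|i] Hi; cbn.
    + destruct (H 0) as [Hn _]; [lia|]. now rewrite Hn.
    + destruct (H (S i)) as [Hn _]; [lia|]. destruct (H i) as [_ Hf]; [lia|].
      now rewrite Hn, Hf.
Qed.

Lemma subst_ext sn sf sn' sf' p :
  (forall i, sn i = sn' i) -> (forall i, sf i = sf' i) ->
  subst sn sf p = subst sn' sf' p.
Proof. intros Hn Hf. destruct (subst_agree p) as [N H]. apply H. auto. Qed.

Lemma subst_id p : subst NVar FVar p = p.
Proof.
  induction p; cbn; rewrite ?subst_n_id; try congruence.
  - now destruct a, b.
  - f_equal. rewrite <- IHp at 2. apply subst_ext; [now intros [|i]|reflexivity].
  - f_equal. rewrite <- IHp at 2. apply subst_ext; [now intros [|i]|reflexivity].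
  - f_equal. rewrite <- IHp at 2. apply subst_ext; [reflexivity|now intros [|i]].
  - f_equal. rewrite <- IHp at 2. apply subst_ext; [reflexivity|now intros [|i]].
Qed.

Lemma subst_comp p : forall sn sf tn tf,
  subst sn sf (subst tn tf p) =
  subst (fun i => subst_n sn sf (tn i)) (fun i => subst_f sf (tf i)) p.
Proof.
  induction p; intros sn sf tn tf; cbn; rewrite ?subst_n_comp, ?subst_f_comp;
    try reflexivity; try (rewrite ?IHp1, ?IHp2; reflexivity).
  all: f_equal; rewrite IHp; apply subst_ext; intros [|i]; cbn;
    rewrite ?subst_n_comp, ?subst_f_comp; try reflexivity.
  all: try (apply subst_n_ext; intros j; cbn; try reflexivity; now destruct (sf j)).
  all: try (now destruct (tf 0)); try (now destruct (tf (S i))).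
Qed.

Lemma subst_instN sn sf t p :
  subst sn sf (instN t p) =
  instN (subst_n sn sf t) (subst (scons (NVar 0) (fun i => subst_n shiftN FVar (sn i))) sf p).
Proof.
  unfold instN. rewrite !subst_comp. apply subst_ext.
  - intros [|i]; cbn; [reflexivity|]. rewrite subst_n_comp. symmetry. apply subst_n_id.
  - intros i. cbn. now destruct (sf i).
Qed.

Lemma subst_instF sn sf a p :
  subst sn sf (instF a p) =
  instF (subst_f sf a)
    (subst (fun i => subst_n NVar shiftF (sn i))
       (scons (FVar 0) (fun i => subst_f shiftF (sf i))) p).
Proof.
  unfold instF. rewrite !subst_comp. apply subst_ext.
  - intros i; cbn. rewrite subst_n_comp. symmetry. apply subst_n_id.
  - intros [|i]; cbn; [reflexivity|]. now destruct (sf i).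
Qed.

Lemma subst_weakN sn sf p :
  subst (scons (NVar 0) (fun i => subst_n shiftN FVar (sn i))) sf (weakN p) =
  weakN (subst sn sf p).
Proof.
  unfold weakN. rewrite !subst_comp. apply subst_ext; intros i; cbn; [reflexivity|].
  now destruct (sf i).
Qed.

Lemma subst_weakF sn sf p :
  subst (fun i => subst_n NVar shiftF (sn i)) (scons (FVar 0) (fun i => subst_f shiftF (sf i)))
    (weakF p) =
  weakF (subst sn sf p).
Proof. unfold weakF. rewrite !subst_comp. now apply subst_ext. Qed.

Lemma instN_up t sn sf p :
  instN t (subst (scons (NVar 0) (fun i => subst_n shiftN FVar (sn i))) sf p) =
  subst (scons t sn) sf p.
Proof.
  unfold instN. rewrite subst_comp. apply subst_ext.
  - intros [|i]; cbn; [reflexivity|]. rewrite subst_n_comp. apply subst_n_id.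
  - intros i. now destruct (sf i).
Qed.

Lemma instF_up a sn sf p :
  instF a (subst (fun i => subst_n NVar shiftF (sn i))
             (scons (FVar 0) (fun i => subst_f shiftF (sf i))) p) =
  subst sn (scons a sf) p.
Proof.
  unfold instF. rewrite subst_comp. apply subst_ext.
  - intros i. rewrite subst_n_comp. apply subst_n_id.
  - intros [|i]; cbn; [reflexivity|]. now destruct (sf i).
Qed.

Lemma instN_weakN t p : instN t (weakN p) = p.
Proof. unfold instN, weakN. rewrite subst_comp. apply subst_id. Qed.

Lemma instF_weakF a p : instF a (weakF p) = p.
Proof. unfold instF, weakF. rewrite subst_comp. apply subst_id. Qed.

(** Closed axioms are fixed by substitution, by computation; the schemes admit arbitrary terms and
    parameters. *)
Lemma BIM_axiom_subst sn sf p : BIM_axiom p -> BIM_axiom (subst sn sf p).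
Proof.
  intros [| | |n i ts|m n g hs ts|n g h ts|n g h t ts|f t| | | |q]; try (cbn; constructor; fail).
  - cbn. rewrite <- (Vector.nth_map (subst_n sn sf) ts i i eq_refl). constructor.
  - cbn. rewrite Vector.map_map. apply Ax_comp.
  - cbn [subst]. rewrite subst_instN.
    set (p' := subst (scons (NVar 0) _) sf q).
    replace (subst _ _ (subst _ FVar q))
      with (subst (scons (succ (NVar 0)) shiftN) FVar p').
    + apply Ax_induction.
    + unfold p'. rewrite !subst_comp. apply subst_ext.
      * intros [|i]; cbn; [reflexivity|]. rewrite subst_n_comp. reflexivity.
      * intros i. cbn. now destruct (sf i).
Qed.

(** * Derivability *)

Lemma prv_subst G p : prv G p ->
  forall sn sf, prv (map (subst sn sf) G) (subst sn sf p).
Proof.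
  assert (WN : forall sn sf G,
    map (subst (scons (NVar 0) (fun i => subst_n shiftN FVar (sn i))) sf) (map weakN G) =
    map weakN (map (subst sn sf) G)).
  { intros. rewrite !map_map. apply map_ext. intros. apply subst_weakN. }
  assert (WF : forall sn sf G,
    map (subst (fun i => subst_n NVar shiftF (sn i))
      (scons (FVar 0) (fun i => subst_f shiftF (sf i)))) (map weakF G) =
    map weakF (map (subst sn sf) G)).
  { intros. rewrite !map_map. apply map_ext. intros. apply subst_weakF. }
  induction 1; intros sn sf; cbn [subst map] in *.
  - apply R_hyp. now apply in_map.
  - now apply R_ax, BIM_axiom_subst.
  - now apply R_botE.
  - now apply R_andI.
  - eapply R_andE1, IHprv.
  - eapply R_andE2, IHprv.
  - now apply R_orI1.
  - now apply R_orI2.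
  - eapply R_orE; eauto.
  - now apply R_impI.
  - eapply R_impE; eauto.
  - apply R_allNI. rewrite <- WN. apply IHprv.
  - rewrite subst_instN. apply R_allNE, IHprv.
  - eapply R_exNI. rewrite <- subst_instN. apply IHprv.
  - eapply R_exNE; [apply IHprv1|].
    rewrite <- WN, <- subst_weakN. apply IHprv2.
  - apply R_allFI. rewrite <- WF. apply IHprv.
  - rewrite subst_instF. apply R_allFE, IHprv.
  - eapply R_exFI. rewrite <- subst_instF. apply IHprv.
  - eapply R_exFE; [apply IHprv1|].
    rewrite <- WF, <- subst_weakF. apply IHprv2.
  - apply R_eqN_refl.
  - rewrite subst_instN. eapply R_eqN_subst; [apply IHprv1|].
    rewrite <- subst_instN. apply IHprv2.
  - apply R_eqF_refl.
  - rewrite subst_instF. eapply R_eqF_subst; [apply IHprv1|].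
    rewrite <- subst_instF. apply IHprv2.
Qed.

Lemma prv_weaken G p : prv G p -> forall G', incl G G' -> prv G' p.
Proof.
  induction 1; intros G' HG.
  - apply R_hyp. now apply HG.
  - now apply R_ax.
  - apply R_botE. auto.
  - apply R_andI; auto.
  - eapply R_andE1; eauto.
  - eapply R_andE2; eauto.
  - apply R_orI1; auto.
  - apply R_orI2; auto.
  - eapply R_orE; [eauto|apply IHprv2|apply IHprv3];
      (apply incl_cons; [now left|now apply incl_tl]).
  - apply R_impI, IHprv. apply incl_cons; [now left|now apply incl_tl].
  - eapply R_impE; eauto.
  - apply R_allNI, IHprv. now apply incl_map.
  - apply R_allNE; auto.
  - eapply R_exNI; eauto.
  - eapply R_exNE; [eauto|apply IHprv2].
    apply incl_cons; [now left|now apply incl_tl, incl_map].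
  - apply R_allFI, IHprv. now apply incl_map.
  - apply R_allFE; auto.
  - eapply R_exFI; eauto.
  - eapply R_exFE; [eauto|apply IHprv2].
    apply incl_cons; [now left|now apply incl_tl, incl_map].
  - apply R_eqN_refl.
  - eapply R_eqN_subst; eauto.
  - apply R_eqF_refl.
  - eapply R_eqF_subst; eauto.
Qed.

Lemma context_agree G : exists N, forall sn sf sn' sf',
  (forall i, i < N -> sn i = sn' i /\ sf i = sf' i) ->
  map (subst sn sf) G = map (subst sn' sf') G.
Proof.
  induction G as [|p G [N IH]].
  - now exists 0.
  - destruct (subst_agree p) as [M H]. exists (N + M). intros sn sf sn' sf' E. cbn.
    f_equal; [apply H|apply IH]; intros i Hi; apply E; lia.
Qed.

(* Instantiate with a variable that is fresh for [G] and [p], and rename it. *)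
Lemma prv_allN G p : (forall t, prv G (instN t p)) -> prv G (AllN p).
Proof.
  intros H. apply R_allNI.
  destruct (context_agree G) as [N HN], (subst_agree p) as [M HM].
  set (x := N + M).
  pose (r := fun j => if Nat.eqb j x then NVar 0 else NVar (S j)).
  assert (Hr : forall j, j < x -> r j = NVar (S j)).
  { intros j Hj. unfold r. destruct (Nat.eqb_spec j x); [lia|reflexivity]. }
  assert (P := prv_subst (H (NVar x)) r FVar).
  replace (map weakN G) with (map (subst r FVar) G).
  2:{ apply HN. intros i Hi. split; [apply Hr; lia|reflexivity]. }
  replace p with (subst r FVar (instN (NVar x) p)); [exact P|].
  unfold instN. rewrite subst_comp. rewrite <- (subst_id p) at 2. apply HM.
  intros [|i] Hi; cbn; (split; [|reflexivity]).
  - unfold r. now rewrite PeanoNat.Nat.eqb_refl.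
  - apply Hr. lia.
Qed.

Lemma prv_allF G p : (forall a, prv G (instF a p)) -> prv G (AllF p).
Proof.
  intros H. apply R_allFI.
  destruct (context_agree G) as [N HN], (subst_agree p) as [M HM].
  set (x := N + M).
  pose (r := fun j => if Nat.eqb j x then FVar 0 else FVar (S j)).
  assert (Hr : forall j, j < x -> r j = FVar (S j)).
  { intros j Hj. unfold r. destruct (Nat.eqb_spec j x); [lia|reflexivity]. }
  assert (P := prv_subst (H (FVar x)) NVar r).
  replace (map weakF G) with (map (subst NVar r) G).
  2:{ apply HN. intros i Hi. split; [reflexivity|apply Hr; lia]. }
  replace p with (subst NVar r (instF (FVar x) p)); [exact P|].
  unfold instF. rewrite subst_comp. rewrite <- (subst_id p) at 2. apply HM.
  intros [|i] Hi; cbn; (split; [reflexivity|]).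
  - unfold r. now rewrite PeanoNat.Nat.eqb_refl.
  - apply Hr. lia.
Qed.

(** The instances are first collected into a universal implication by [prv_allN]; after weakening,
    this is instantiated at the eigenvariable [NVar 0] of [R_exNE]. *)
Lemma prv_exN G p r :
  prv G (ExN p) -> (forall t, prv (instN t p :: G) r) -> prv G r.
Proof.
  intros H K. apply (R_exNE H).
  assert (A : prv G (AllN (Imp p (weakN r)))).
  { apply prv_allN. intros t. unfold instN. cbn [subst].
    fold (instN t p) (instN t (weakN r)). rewrite instN_weakN. apply R_impI, K. }
  assert (B : prv (map weakN G) (Imp p (weakN r))).
  { replace (Imp p (weakN r)) with
      (instN (NVar 0) (subst (scons (NVar 0) (fun i => subst_n shiftN FVar (shiftN i))) FVar
         (Imp p (weakN r)))).
    2:{ rewrite instN_up. rewrite <- (subst_id (Imp p (weakN r))) at 2.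
        apply subst_ext; [now intros [|i]|reflexivity]. }
    apply R_allNE. exact (prv_subst A shiftN FVar). }
  eapply R_impE; [|apply R_hyp; now left].
  apply (prv_weaken B). now apply incl_tl, incl_refl.
Qed.

Lemma prv_exF G p r :
  prv G (ExF p) -> (forall a, prv (instF a p :: G) r) -> prv G r.
Proof.
  intros H K. apply (R_exFE H).
  assert (A : prv G (AllF (Imp p (weakF r)))).
  { apply prv_allF. intros t. unfold instF. cbn [subst].
    fold (instF t p) (instF t (weakF r)). rewrite instF_weakF. apply R_impI, K. }
  assert (B : prv (map weakF G) (Imp p (weakF r))).
  { replace (Imp p (weakF r)) with
      (instF (FVar 0) (subst (fun i => subst_n NVar shiftF (NVar i))
         (scons (FVar 0) (fun i => subst_f shiftF (shiftF i)))
         (Imp p (weakF r)))).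
    2:{ rewrite instF_up. rewrite <- (subst_id (Imp p (weakF r))) at 2.
        apply subst_ext; [reflexivity|now intros [|i]]. }
    apply R_allFE. exact (prv_subst A NVar shiftF). }
  eapply R_impE; [|apply R_hyp; now left].
  apply (prv_weaken B). now apply incl_tl, incl_refl.
Qed.

(** * A shallow embedding of the provable formulas *)

(* [holds_stable] says that [holds] is an intersection of Heyting implications into
   derivability predicates; it is what allows eliminating disjunctions,
   existential quantifiers and absurdity into [U]. *)
Record oprop : Type := Oprop {
  holds : list form -> Prop;
  holds_mono : forall G G', incl G G' -> holds G -> holds G';
  holds_stable : forall G,
    (forall G' r, incl G G' ->
       (forall G'', incl G' G'' -> holds G'' -> prv G'' r) -> prv G' r) ->
    holds G }.

Declare Scope oprop_scope.
Delimit Scope oprop_scope with o.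
Bind Scope oprop_scope with oprop.

Notation "G ||- P" := (holds P%o G) (at level 80, P at level 200).

Definition oPrv (p : form) : oprop.
Proof.
  refine (@Oprop (fun G => prv G p) _ _).
  - intros G G' HG H. now apply (prv_weaken H).
  - intros G H. apply (H G p); [apply incl_refl|auto].
Defined.

Definition oEq (s t : nterm) : oprop := oPrv (EqN s t).
Definition oEqF (a b : fterm) : oprop := oPrv (EqF a b).
Definition oBot : oprop := oPrv Bot.

Definition oAnd (P Q : oprop) : oprop.
Proof.
  refine (@Oprop (fun G => (G ||- P) /\ (G ||- Q)) _ _).
  - intros G G' HG [HP HQ]. split; eapply holds_mono; eauto.
  - intros G H. split; apply holds_stable; intros G' r HG K; apply (H G' r HG);
      intros G'' HG' [HP HQ]; auto.
Defined.

Definition oImp (P Q : oprop) : oprop.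
Proof.
  refine (@Oprop (fun G => forall G', incl G G' -> (G' ||- P) -> (G' ||- Q)) _ _).
  - intros G G' HG H G'' HG'. apply H. eapply incl_tran; eauto.
  - intros G H G1 HG1 HP. apply holds_stable. intros G' r HG K.
    apply (H G' r); [eapply incl_tran; eauto|].
    intros G'' HG' HPQ. apply K; [assumption|]. apply HPQ; [apply incl_refl|].
    eapply holds_mono; [|exact HP]. eapply incl_tran; eauto.
Defined.

Definition oAll (T : Type) (P : T -> oprop) : oprop.
Proof.
  refine (@Oprop (fun G => forall x, G ||- P x) _ _).
  - intros G G' HG H x. eapply holds_mono; eauto.
  - intros G H x. apply holds_stable. intros G' r HG K. apply (H G' r HG). auto.
Defined.

(** The existential is encoded by its elimination rule into derivable formulas: derivability of an
    existential formula need not come with a witnessing term, so a Rocq [exists] would be too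
    strong. *)
Definition oEx (T : Type) (P : T -> oprop) : oprop.
Proof.
  refine (@Oprop (fun G => forall G' r, incl G G' ->
    (forall x G'', incl G' G'' -> (G'' ||- P x) -> prv G'' r) -> prv G' r) _ _).
  - intros G G' HG H G'' r HG'. apply H. eapply incl_tran; eauto.
  - intros G H G' r HG K. apply (H G' r HG). intros G'' HG' U.
    apply (U G''); [apply incl_refl|]. intros x G1 HG1. apply K. eapply incl_tran; eauto.
Defined.

Definition oOr (P Q : oprop) : oprop := oEx (fun b : bool => if b then P else Q).

Notation "s == t" := (oEq s t) (at level 70, no associativity) : oprop_scope.
Notation "s =/= t" := (oImp (oEq s t) oBot) (at level 70, no associativity) : oprop_scope.
Notation "P /\ Q" := (oAnd P Q) : oprop_scope.
Notation "P \/ Q" := (oOr P Q) : oprop_scope.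
Notation "P -> Q" := (oImp P Q) : oprop_scope.
Notation "'forN' x , P" := (oAll (fun x : nterm => P%o))
  (at level 200, x name, right associativity) : oprop_scope.
Notation "'exN' x , P" := (oEx (fun x : nterm => P%o))
  (at level 200, x name, right associativity) : oprop_scope.
Notation "'forF' x , P" := (oAll (fun x : fterm => P%o))
  (at level 200, x name, right associativity) : oprop_scope.
Notation "'exF' x , P" := (oEx (fun x : fterm => P%o))
  (at level 200, x name, right associativity) : oprop_scope.

Lemma botE G Q : (G ||- oBot) -> (G ||- Q).
Proof.
  intros H. apply holds_stable. intros G' r HG K. apply R_botE. exact (prv_weaken H HG).
Qed.

Lemma exI (T : Type) (x : T) G (P : T -> oprop) : (G ||- P x) -> (G ||- oEx P).
Proof.
  intros H G' r HG K. apply (K x G'); [apply incl_refl|]. exact (holds_mono HG H).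
Qed.

Lemma exE (T : Type) G (P : T -> oprop) Q :
  (G ||- oEx P) -> (forall G', incl G G' -> forall x, (G' ||- P x) -> (G' ||- Q)) -> (G ||- Q).
Proof.
  intros H K. apply holds_stable. intros G' r HG C. apply (H G' r HG).
  intros x G'' HG' HP. apply (C G'' HG'). exact (K G'' (incl_tran HG HG') x HP).
Qed.

Lemma orI1 G P Q : (G ||- P) -> (G ||- P \/ Q).
Proof. exact (@exI bool true G (fun b => if b then P else Q)). Qed.

Lemma orI2 G P Q : (G ||- Q) -> (G ||- P \/ Q).
Proof. exact (@exI bool false G (fun b => if b then P else Q)). Qed.

Lemma orE G P Q R : (G ||- P \/ Q) ->
  (forall G', incl G G' -> (G' ||- P) -> (G' ||- R)) ->
  (forall G', incl G G' -> (G' ||- Q) -> (G' ||- R)) -> (G ||- R).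
Proof.
  intros H K1 K2. apply (exE (Q := R) H). intros G' HG [|]; [now apply K1|now apply K2].
Qed.

Lemma impE G P Q : (G ||- P -> Q) -> (G ||- P) -> (G ||- Q).
Proof. intros H. apply H, incl_refl. Qed.

Definition represents (P : oprop) (p : form) : Prop := forall G, (G ||- P) <-> prv G p.

Lemma represents_and P Q p q :
  represents P p -> represents Q q -> represents (P /\ Q) (And p q).
Proof.
  intros HP HQ G. split.
  - intros [H1 H2]. apply R_andI; [now apply HP|now apply HQ].
  - intros H. split; [apply HP; eapply R_andE1; eauto|apply HQ; eapply R_andE2; eauto].
Qed.

Lemma represents_or P Q p q :
  represents P p -> represents Q q -> represents (P \/ Q) (Or p q).
Proof.
  intros HP HQ G. split.
  - intros H. refine (H G _ (incl_refl G) _).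
    intros [|] G' _ K; [apply R_orI1, HP, K|apply R_orI2, HQ, K].
  - intros H G' r HG K. apply (R_orE (prv_weaken H HG)).
    + apply (K true); [now apply incl_tl|]. apply HP, R_hyp. now left.
    + apply (K false); [now apply incl_tl|]. apply HQ, R_hyp. now left.
Qed.

Lemma represents_imp P Q p q :
  represents P p -> represents Q q -> represents (P -> Q) (Imp p q).
Proof.
  intros HP HQ G. split.
  - intros H. apply R_impI, HQ, H; [now apply incl_tl|]. apply HP, R_hyp. now left.
  - intros H G' HG K. apply HQ. apply (R_impE (prv_weaken H HG)), HP, K.
Qed.

Lemma represents_allN P sn sf p :
  (forall t, represents (P t) (subst (scons t sn) sf p)) ->
  represents (oAll P) (subst sn sf (AllN p)).
Proof.
  intros HP G. cbn [subst]. split.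
  - intros H. apply prv_allN. intros t. rewrite instN_up. apply HP, H.
  - intros H t. apply HP. rewrite <- (instN_up t sn sf p). now apply R_allNE.
Qed.

Lemma represents_allF P sn sf p :
  (forall a, represents (P a) (subst sn (scons a sf) p)) ->
  represents (oAll P) (subst sn sf (AllF p)).
Proof.
  intros HP G. cbn [subst]. split.
  - intros H. apply prv_allF. intros t. rewrite instF_up. apply HP, H.
  - intros H t. apply HP. rewrite <- (instF_up t sn sf p). now apply R_allFE.
Qed.

Lemma represents_exN P sn sf p :
  (forall t, represents (P t) (subst (scons t sn) sf p)) ->
  represents (oEx P) (subst sn sf (ExN p)).
Proof.
  intros HP G. cbn [subst]. split.
  - intros H. refine (H G _ (incl_refl G) _). intros t G' _ K.
    apply R_exNI with (t := t). rewrite instN_up. apply HP, K.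
  - intros H G' r HG K. apply (prv_exN (prv_weaken H HG)). intros t.
    apply (K t (_ :: _)); [now apply incl_tl|]. apply HP. rewrite <- (instN_up t sn sf p).
    apply R_hyp. now left.
Qed.

Lemma represents_exF P sn sf p :
  (forall a, represents (P a) (subst sn (scons a sf) p)) ->
  represents (oEx P) (subst sn sf (ExF p)).
Proof.
  intros HP G. cbn [subst]. split.
  - intros H. refine (H G _ (incl_refl G) _). intros t G' _ K.
    apply R_exFI with (a := t). rewrite instF_up. apply HP, K.
  - intros H G' r HG K. apply (prv_exF (prv_weaken H HG)). intros t.
    apply (K t (_ :: _)); [now apply incl_tl|]. apply HP. rewrite <- (instF_up t sn sf p).
    apply R_hyp. now left.
Qed.

(** Substitutions are kept as environments, so the meaning of a concrete sentence computes to a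
    statement with Rocq binders; axioms and the final theorem are recognised by conversion. *)
Fixpoint sem (sn : nat -> nterm) (sf : nat -> fterm) (p : form) : oprop :=
  match p with
  | EqN s t => oEq (subst_n sn sf s) (subst_n sn sf t)
  | EqF a b => oEqF (subst_f sf a) (subst_f sf b)
  | Bot => oBot
  | And p q => oAnd (sem sn sf p) (sem sn sf q)
  | Or p q => oOr (sem sn sf p) (sem sn sf q)
  | Imp p q => oImp (sem sn sf p) (sem sn sf q)
  | AllN p => oAll (fun t => sem (scons t sn) sf p)
  | ExN p => oEx (fun t => sem (scons t sn) sf p)
  | AllF p => oAll (fun a => sem sn (scons a sf) p)
  | ExF p => oEx (fun a => sem sn (scons a sf) p)
  end.

Lemma represents_sem p : forall sn sf, represents (sem sn sf p) (subst sn sf p).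
Proof.
  induction p; intros sn sf; try (intros G; reflexivity).
  - apply represents_and; auto.
  - apply represents_or; auto.
  - apply represents_imp; auto.
  - apply represents_allN. auto.
  - apply represents_exN. auto.
  - apply represents_allF. auto.
  - apply represents_exF. auto.
Qed.

Lemma sem_axiom sn sf p G : BIM_axiom p -> G ||- sem sn sf p.
Proof. intros H. apply represents_sem, R_ax. now apply BIM_axiom_subst. Qed.

(** * Definability *)

(* The first [k] variables are local, the others are parameters and keep their
   meaning; so a constant is defined by its own shift. *)
Definition local (T : Type) (var : nat -> T) (k : nat) (loc : nat -> T) (i : nat) : T :=
  if i <? k then loc i else var (i - k).

Notation localN := (local NVar).
Notation localF := (local FVar).

(** The induction scheme and the equality rules speak of formulas, whereas an arbitrary Rocq
    predicate on terms need not be given by one. The closure lemmas let [dfn] find the formula by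
    following the syntax of the predicate. *)
Definition definable (k l : nat) (P : (nat -> nterm) -> (nat -> fterm) -> oprop) : Prop :=
  exists p, forall loc locF,
    represents (P loc locF) (subst (localN k loc) (localF l locF) p).

Definition definable_n (k l : nat) (f : (nat -> nterm) -> (nat -> fterm) -> nterm) : Prop :=
  exists t, forall loc locF, f loc locF = subst_n (localN k loc) (localF l locF) t.

Definition definable_v (k l n : nat)
    (f : (nat -> nterm) -> (nat -> fterm) -> Vector.t nterm n) : Prop :=
  exists ts, forall loc locF,
    f loc locF = Vector.map (subst_n (localN k loc) (localF l locF)) ts.

Definition definable_f (l : nat) (a : (nat -> fterm) -> fterm) : Prop :=
  exists b, forall locF, a locF = subst_f (localF l locF) b.

Lemma local_shift T (var : nat -> T) k loc i : local var k loc (i + k) = var i.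
Proof.
  unfold local. destruct (Nat.ltb_spec (i + k) k); [lia|]. f_equal. lia.
Qed.

Lemma local_local T (var : nat -> T) k loc i : (i <? k) = true -> loc i = local var k loc i.
Proof. intros H. unfold local. now rewrite H. Qed.

Lemma local_scons T (var : nat -> T) k loc x i :
  scons x (local var k loc) i = local var (S k) (scons x loc) i.
Proof. destruct i; [reflexivity|]. unfold local. cbn. reflexivity. Qed.

Lemma dfn_f_const l a : definable_f l (fun _ => a).
Proof.
  destruct a as [i|f]; [exists (FVar (i + l))|exists (FPr f)]; intros locF; cbn;
    now rewrite ?local_shift.
Qed.

Lemma dfn_f_loc l i : (i <? l) = true -> definable_f l (fun locF => locF i).
Proof. intros H. exists (FVar i). intros locF. now apply local_local. Qed.

Lemma dfn_n_const k l t : definable_n k l (fun _ _ => t).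
Proof.
  exists (subst_n (fun i => NVar (i + k)) (fun i => FVar (i + l)) t). intros loc locF.
  rewrite subst_n_comp. symmetry. rewrite <- (subst_n_id t) at 2.
  apply subst_n_ext; intros i; apply local_shift.
Qed.

Lemma dfn_n_loc k l i : (i <? k) = true -> definable_n k l (fun loc _ => loc i).
Proof. intros H. exists (NVar i). intros loc locF. now apply local_local. Qed.

Lemma dfn_n_app k l a f :
  definable_f l a -> definable_n k l f ->
  definable_n k l (fun loc locF => NApp (a locF) (f loc locF)).
Proof.
  intros [b Hb] [t Ht]. exists (NApp b t). intros loc locF. cbn. now rewrite Hb, Ht.
Qed.

Lemma dfn_n_pr k l n (g : prf n) f :
  definable_v k l f -> definable_n k l (fun loc locF => NPr g (f loc locF)).
Proof. intros [ts Hts]. exists (NPr g ts). intros loc locF. cbn. now rewrite Hts. Qed.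

Lemma dfn_v_const k l n (ts : Vector.t nterm n) : definable_v k l (fun _ _ => ts).
Proof.
  induction ts as [|t n ts [us IH]]; [now exists (Vector.nil _)|].
  destruct (dfn_n_const k l t) as [u Hu]. exists (Vector.cons _ u _ us).
  intros loc locF. cbn. now rewrite <- Hu, <- IH.
Qed.

Lemma dfn_v_cons k l n f (fs : _ -> _ -> Vector.t nterm n) :
  definable_n k l f -> definable_v k l fs ->
  definable_v k l (fun loc locF => Vector.cons _ (f loc locF) _ (fs loc locF)).
Proof.
  intros [t Ht] [ts Hts]. exists (Vector.cons _ t _ ts). intros loc locF. cbn.
  now rewrite Ht, Hts.
Qed.

Lemma dfn_eq k l f g :
  definable_n k l f -> definable_n k l g ->
  definable k l (fun loc locF => oEq (f loc locF) (g loc locF)).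
Proof.
  intros [s Hs] [t Ht]. exists (EqN s t). intros loc locF G. rewrite Hs, Ht. reflexivity.
Qed.

Lemma dfn_bot k l : definable k l (fun _ _ => oBot).
Proof. exists Bot. intros loc locF G. reflexivity. Qed.

Lemma dfn_and k l P Q :
  definable k l P -> definable k l Q ->
  definable k l (fun loc locF => oAnd (P loc locF) (Q loc locF)).
Proof.
  intros [p HP] [q HQ]. exists (And p q). intros loc locF. now apply represents_and.
Qed.

Lemma dfn_or k l P Q :
  definable k l P -> definable k l Q ->
  definable k l (fun loc locF => oOr (P loc locF) (Q loc locF)).
Proof.
  intros [p HP] [q HQ]. exists (Or p q). intros loc locF. now apply represents_or.
Qed.

Lemma dfn_imp k l P Q :
  definable k l P -> definable k l Q ->
  definable k l (fun loc locF => oImp (P loc locF) (Q loc locF)).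
Proof.
  intros [p HP] [q HQ]. exists (Imp p q). intros loc locF. now apply represents_imp.
Qed.

Section Quantifiers.
Variables (k l : nat).

Let bodyN (P : (nat -> nterm) -> (nat -> fterm) -> nterm -> oprop) :=
  definable (S k) l (fun loc locF => P (fun i => loc (S i)) locF (loc 0)).
Let bodyF (P : (nat -> nterm) -> (nat -> fterm) -> fterm -> oprop) :=
  definable k (S l) (fun loc locF => P loc (fun i => locF (S i)) (locF 0)).

Let bodyN_represents P : bodyN P -> exists p, forall loc locF t,
  represents (P loc locF t) (subst (scons t (localN k loc)) (localF l locF) p).
Proof.
  intros [p H]. exists p. intros loc locF t.
  rewrite (subst_ext p (local_scons NVar k loc t) (fun i => eq_refl)).
  exact (H (scons t loc) locF).
Qed.

Let bodyF_represents P : bodyF P -> exists p, forall loc locF a,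
  represents (P loc locF a) (subst (localN k loc) (scons a (localF l locF)) p).
Proof.
  intros [p H]. exists p. intros loc locF a.
  rewrite (subst_ext p (fun i => eq_refl) (local_scons FVar l locF a)).
  exact (H loc (scons a locF)).
Qed.

Lemma dfn_allN P : bodyN P -> definable k l (fun loc locF => oAll (fun t => P loc locF t)).
Proof.
  intros [p H]%bodyN_represents. exists (AllN p). intros loc locF.
  apply represents_allN. intros t. apply H.
Qed.

Lemma dfn_exN P : bodyN P -> definable k l (fun loc locF => oEx (fun t => P loc locF t)).
Proof.
  intros [p H]%bodyN_represents. exists (ExN p). intros loc locF.
  apply represents_exN. intros t. apply H.
Qed.

Lemma dfn_allF P : bodyF P -> definable k l (fun loc locF => oAll (fun t => P loc locF t)).
Proof.
  intros [p H]%bodyF_represents. exists (AllF p). intros loc locF.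
  apply represents_allF. intros t. apply H.
Qed.

Lemma dfn_exF P : bodyF P -> definable k l (fun loc locF => oEx (fun t => P loc locF t)).
Proof.
  intros [p H]%bodyF_represents. exists (ExF p). intros loc locF.
  apply represents_exF. intros t. apply H.
Qed.
End Quantifiers.

Ltac dfn :=
  cbv beta;
  lazymatch goal with
  | |- definable_f _ _ => first [apply dfn_f_const | apply dfn_f_loc; reflexivity]
  | |- definable_n _ _ (fun loc locF => ?t) =>
      first [apply dfn_n_const | apply dfn_n_loc; reflexivity
            | apply dfn_n_app | apply dfn_n_pr]; dfn
  | |- definable_v _ _ _ => first [assumption | apply dfn_v_const | apply dfn_v_cons]; dfn
  | |- definable _ _ _ =>
      first [ apply dfn_eq | apply dfn_bot | apply dfn_and | apply dfn_imp | apply dfn_or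
            | apply dfn_allN | apply dfn_exN | apply dfn_allF | apply dfn_exF ]; dfn
  | |- _ => idtac
  end.

Lemma induction_definable (Q : nterm -> oprop) G :
  definable 1 0 (fun loc _ => Q (loc 0)) ->
  (G ||- Q zero) ->
  (forall G', incl G G' -> forall n, (G' ||- Q n) -> (G' ||- Q (succ n))) ->
  forall t, G ||- Q t.
Proof.
  intros [p Hp] H0 HS.
  set (sn := localN 0 NVar). set (sf := localF 0 FVar).
  assert (E : forall t, represents (Q t) (subst (scons t sn) sf p)).
  { intros t G'. rewrite (Hp (scons t NVar) FVar G').
    rewrite (subst_ext p (local_scons NVar 0 NVar t) (fun i => eq_refl)). reflexivity. }
  assert (A := R_ax G (BIM_axiom_subst sn sf (Ax_induction p))). cbn [subst] in A.
  assert (B : represents (forN t, Q t) (subst sn sf (AllN p))).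
  { apply represents_allN. exact E. }
  apply B. refine (R_impE A _). clear A B. apply R_andI.
  - rewrite subst_instN, instN_up. apply E. exact H0.
  - change (prv G (subst sn sf (AllN (Imp p (subst (scons (succ (NVar 0)) shiftN) FVar p))))).
    refine (proj1 (@represents_allN (fun t => Q t -> Q (succ t))%o sn sf _ _ G) _).
    + intros t. apply represents_imp; [apply E|].
      rewrite subst_comp.
      replace (subst _ _ p) with (subst (scons (succ t) sn) sf p); [apply E|].
      apply subst_ext; [intros [|i]|]; reflexivity.
    + intros t G' HG. exact (HS G' HG t).
Qed.

Lemma eq_subst (Q : nterm -> oprop) G s t :
  definable 1 0 (fun loc _ => Q (loc 0)) ->
  (G ||- s == t) -> (G ||- Q s) -> (G ||- Q t).
Proof.
  intros [p Hp] Hst Hs.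
  set (sn := localN 0 NVar). set (sf := localF 0 FVar).
  assert (E : forall t, represents (Q t)
     (instN t (subst (scons (NVar 0) (fun i => subst_n shiftN FVar (sn i))) sf p))).
  { intros u. rewrite instN_up. intros G'. rewrite (Hp (scons u NVar) FVar G').
    rewrite (subst_ext p (local_scons NVar 0 NVar u) (fun i => eq_refl)). reflexivity. }
  apply E. apply (R_eqN_subst Hst). apply E, Hs.
Qed.

(** * Equational reasoning *)

Definition eqn (G : list form) (s t : nterm) : Prop := G ||- s == t.

#[export] Instance eqn_equivalence G : Equivalence (eqn G).
Proof.
  assert (S : forall s t, eqn G s t -> eqn G t s).
  { intros s t H. apply (@eq_subst (fun x => x == s)%o G s t); [dfn|exact H|apply R_eqN_refl]. }
  split; [intros s; apply R_eqN_refl|exact S|].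
  intros s t u Hst Htu.
  apply (@eq_subst (fun x => s == x)%o G t u); [dfn|exact Htu|exact Hst].
Qed.

Lemma vec_subst G n (ts ts' : Vector.t nterm n) : Vector.Forall2 (eqn G) ts ts' ->
  forall Q : Vector.t nterm n -> oprop,
  (forall k l v, definable_v k l v -> definable k l (fun loc locF => Q (v loc locF))) ->
  (G ||- Q ts) -> (G ||- Q ts').
Proof.
  induction 1 as [|n t t' ts ts' Ht _ IH]; intros Q HQ H; [exact H|].
  apply (IH (fun us => Q (Vector.cons _ t' _ us))).
  - intros k l v Hv. apply HQ. dfn.
  - refine (@eq_subst (fun x => Q (Vector.cons _ x _ ts)) G t t' _ Ht H). apply HQ. dfn.
Qed.

Lemma npr_congr G n (f : prf n) ts ts' :
  Vector.Forall2 (eqn G) ts ts' -> eqn G (NPr f ts) (NPr f ts').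
Proof.
  intros H. apply (@vec_subst G n ts ts' H (fun us => NPr f ts == NPr f us)%o).
  - intros k l v Hv. dfn.
  - apply R_eqN_refl.
Qed.

(** Projections and compositions are evaluated by Rocq, while zero, successor and recursions are
    left in place; defining equations of derived functions thus hold up to conversion after
    [unfold_pr_eq]. *)
Fixpoint unfold_pr n (f : prf n) : Vector.t nterm n -> nterm :=
  match f with
  | PProj i => fun ts => Vector.nth ts i
  | PComp g hs => fun ts => unfold_pr g (Vector.map (fun h => unfold_pr h ts) hs)
  | f => fun ts => NPr f ts
  end.

Lemma prf_nested_ind (P : forall n, prf n -> Prop) :
  P 0 PZero -> P 1 PSucc -> (forall n i, P n (PProj i)) ->
  (forall m n (g : prf m) (hs : Vector.t (prf n) m),
     P m g -> Vector.Forall (P n) hs -> P n (PComp g hs)) ->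
  (forall n (g : prf n) h, P n g -> P (S (S n)) h -> P (S n) (PRec g h)) ->
  forall n (f : prf n), P n f.
Proof.
  intros H0 HS HP HC HR. fix IH 2. intros n [| |k i|m k g hs|k g h].
  - exact H0.
  - exact HS.
  - apply HP.
  - apply HC; [apply IH|]. clear g. induction hs as [|h m hs IHhs]; [constructor|].
    constructor; [apply IH|exact IHhs].
  - apply HR; apply IH.
Qed.

Lemma unfold_pr_eq G n (f : prf n) : forall ts, eqn G (NPr f ts) (unfold_pr f ts).
Proof.
  induction f as [| |n i|m n g hs IHg IHhs|n g h] using prf_nested_ind; intros ts;
    try reflexivity.
  - apply R_ax, Ax_proj.
  - cbn [unfold_pr].
    transitivity (NPr g (Vector.map (fun h => NPr h ts) hs)); [apply R_ax, Ax_comp|].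
    rewrite <- IHg. apply npr_congr. clear g IHg.
    induction IHhs as [|m h hs Hh _ IH]; cbn; constructor; [apply Hh|exact IH].
Qed.

Lemma rec_zero G n (g : prf n) h ts :
  eqn G (NPr (PRec g h) (Vector.cons _ zero _ ts)) (unfold_pr g ts).
Proof. rewrite <- unfold_pr_eq. apply R_ax, Ax_rec0. Qed.

Lemma rec_succ G n (g : prf n) h t ts :
  eqn G (NPr (PRec g h) (Vector.cons _ (succ t) _ ts))
    (unfold_pr h (Vector.cons _ t _ (Vector.cons _ (NPr (PRec g h) (Vector.cons _ t _ ts)) _ ts))).
Proof. rewrite <- unfold_pr_eq. apply R_ax, Ax_recS. Qed.

Lemma app_const G (f : prf 1) t :
  eqn G (NApp (FPr f) t) (unfold_pr f (Vector.cons _ t _ (Vector.nil _))).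
Proof. rewrite <- unfold_pr_eq. apply R_ax, Ax_const. Qed.

#[export] Instance app_proper G a : Proper (eqn G ==> eqn G) (NApp a).
Proof.
  intros s t H. apply (@eq_subst (fun x => NApp a s == NApp a x)%o G s t);
    [dfn|exact H|apply R_eqN_refl].
Qed.

Ltac npr_proper :=
  repeat intro; apply npr_congr; repeat (apply Vector.Forall2_cons; [assumption|]);
  apply Vector.Forall2_nil.

#[export] Instance succ_proper G : Proper (eqn G ==> eqn G) succ.
Proof. npr_proper. Qed.
#[export] Instance add_proper G : Proper (eqn G ==> eqn G ==> eqn G) add.
Proof. npr_proper. Qed.
#[export] Instance pair_proper G : Proper (eqn G ==> eqn G ==> eqn G) pair.
Proof. npr_proper. Qed.

Section Primitive_recursive.
Import Vector.VectorNotations.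
Local Open Scope vector_scope.

Let x0 n : prf (S n) := PProj Fin.F1.
Let x1 n : prf (S (S n)) := PProj (Fin.FS Fin.F1).
Let x2 n : prf (S (S (S n))) := PProj (Fin.FS (Fin.FS Fin.F1)).

Definition pr_pred : prf 1 := PRec PZero (x0 1).
(* [pr_rsub] takes the subtrahend first. *)
Definition pr_rsub : prf 2 := PRec (x0 0) (PComp pr_pred [x1 1]).
Definition pr_ifz : prf 3 := PRec (x0 1) (PProj (Fin.FS (Fin.FS (Fin.FS Fin.F1)))).

(* The [k] with [tri k <= p < tri (k + 1)] *)
Definition pr_diag : prf 1 :=
  PRec PZero (PComp pr_ifz
    [PComp pr_rsub [PComp PSucc [x0 1]; PComp pr_tri [PComp PSucc [x1 0]]];
     PComp PSucc [x1 0]; x1 0]).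
Definition pr_snd : prf 1 := PComp pr_rsub [PComp pr_tri [pr_diag]; x0 0].
Definition pr_fst : prf 1 := PComp pr_rsub [pr_snd; pr_diag].

(* [pr_pre (k, x)] is [s + 1] if [x = s * <i_1, ..., i_k>], and [0] if [x] has
   fewer than [k] entries. *)
Definition pr_pre : prf 2 :=
  PRec PSucc (PComp pr_ifz
    [PComp pr_pred [x1 1]; PComp PZero [];
     PComp PSucc [PComp pr_fst [PComp pr_pred [PComp pr_pred [x1 1]]]]]).

Definition pred (t : nterm) : nterm := NPr pr_pred [t].
Definition sub (s t : nterm) : nterm := NPr pr_rsub [t; s].
Definition ifz (t u v : nterm) : nterm := NPr pr_ifz [t; u; v].
Definition tri (t : nterm) : nterm := NPr pr_tri [t].
Definition diag (t : nterm) : nterm := NPr pr_diag [t].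
Definition fst (t : nterm) : nterm := NPr pr_fst [t].
Definition snd (t : nterm) : nterm := NPr pr_snd [t].
Definition pre (k x : nterm) : nterm := NPr pr_pre [k; x].
Definition dist (s t : nterm) : nterm := add (sub s t) (sub t s).
End Primitive_recursive.

#[export] Instance pred_proper G : Proper (eqn G ==> eqn G) pred.
Proof. npr_proper. Qed.
#[export] Instance sub_proper G : Proper (eqn G ==> eqn G ==> eqn G) sub.
Proof. npr_proper. Qed.
#[export] Instance ifz_proper G : Proper (eqn G ==> eqn G ==> eqn G ==> eqn G) ifz.
Proof. npr_proper. Qed.
#[export] Instance tri_proper G : Proper (eqn G ==> eqn G) tri.
Proof. npr_proper. Qed.
#[export] Instance diag_proper G : Proper (eqn G ==> eqn G) diag.
Proof. npr_proper. Qed.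
#[export] Instance fst_proper G : Proper (eqn G ==> eqn G) fst.
Proof. npr_proper. Qed.
#[export] Instance snd_proper G : Proper (eqn G ==> eqn G) snd.
Proof. npr_proper. Qed.
#[export] Instance pre_proper G : Proper (eqn G ==> eqn G ==> eqn G) pre.
Proof. npr_proper. Qed.
#[export] Instance dist_proper G : Proper (eqn G ==> eqn G ==> eqn G) dist.
Proof. intros s s' Hs t t' Ht. unfold dist. now rewrite Hs, Ht. Qed.

Section Equations.
Variable G : list form.

Lemma add_0_l n : eqn G (add zero n) n. Proof. apply rec_zero. Qed.
Lemma add_S_l m n : eqn G (add (succ m) n) (succ (add m n)). Proof. apply rec_succ. Qed.
Lemma pred_0 : eqn G (pred zero) zero. Proof. apply rec_zero. Qed.
Lemma pred_S n : eqn G (pred (succ n)) n. Proof. apply rec_succ. Qed.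
Lemma sub_0_r n : eqn G (sub n zero) n. Proof. apply rec_zero. Qed.
Lemma sub_S_r m n : eqn G (sub m (succ n)) (pred (sub m n)).
Proof. apply rec_succ. Qed.
Lemma ifz_0 u v : eqn G (ifz zero u v) u. Proof. apply rec_zero. Qed.
Lemma ifz_S t u v : eqn G (ifz (succ t) u v) v. Proof. apply rec_succ. Qed.
Lemma tri_0 : eqn G (tri zero) zero. Proof. apply rec_zero. Qed.
Lemma tri_S n : eqn G (tri (succ n)) (add (succ n) (tri n)). Proof. apply rec_succ. Qed.
Lemma diag_0 : eqn G (diag zero) zero. Proof. apply rec_zero. Qed.
Lemma diag_S n : eqn G (diag (succ n))
  (ifz (sub (tri (succ (diag n))) (succ n)) (succ (diag n)) (diag n)).
Proof. apply rec_succ. Qed.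
Lemma pair_eq m n : eqn G (pair m n) (add (tri (add m n)) n).
Proof. apply (unfold_pr_eq G pr_pair). Qed.
Lemma snd_eq p : eqn G (snd p) (sub p (tri (diag p))).
Proof. apply (unfold_pr_eq G pr_snd). Qed.
Lemma fst_eq p : eqn G (fst p) (sub (diag p) (snd p)).
Proof. rewrite snd_eq. apply (unfold_pr_eq G pr_fst). Qed.
Lemma pre_0 x : eqn G (pre zero x) (succ x). Proof. apply rec_zero. Qed.
Lemma pre_S_unfold k x : eqn G (pre (succ k) x)
  (ifz (pred (pre k x)) zero (succ (fst (pred (pred (pre k x)))))).
Proof.
  rewrite fst_eq, snd_eq. apply rec_succ.
Qed.
End Equations.

(** * Reasoning inside BIM *)

Lemma eqn_mono G G' s t : incl G G' -> eqn G s t -> eqn G' s t.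
Proof. apply holds_mono. Qed.

Lemma eqn_mono1 (T : Type) G G' (f g : T -> nterm) : incl G G' ->
  (forall x, eqn G (f x) (g x)) -> forall x, eqn G' (f x) (g x).
Proof. intros HG H x. now apply (eqn_mono HG). Qed.

Lemma eqn_mono2 (T U : Type) G G' (f g : T -> U -> nterm) : incl G G' ->
  (forall x y, eqn G (f x y) (g x y)) -> forall x y, eqn G' (f x y) (g x y).
Proof. intros HG H x y. now apply (eqn_mono HG). Qed.

Ltac fold_eqn :=
  repeat match goal with
  | H : holds (oEq ?s ?t) ?G |- _ => change (eqn G s t) in H
  | |- holds (oEq ?s ?t) ?G => change (eqn G s t)
  end.

(* Moves to an extended context, transporting all hypotheses. *)
Ltac extend :=
  let G' := fresh "G" in let HG := fresh "HG" in
  intros G' HG;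
  lazymatch type of HG with incl ?G _ =>
    repeat match goal with
    | H : holds _ G |- _ => apply (holds_mono HG) in H
    | H : eqn G _ _ |- _ => apply (eqn_mono HG) in H
    | H : forall x, eqn G (@?f x) (@?g x) |- _ =>
        let H' := fresh in pose proof (@eqn_mono1 _ _ _ f g HG H) as H';
        clear H; rename H' into H; cbv beta in H
    | H : forall x y, eqn G (@?f x y) (@?g x y) |- _ =>
        let H' := fresh in pose proof (@eqn_mono2 _ _ _ _ f g HG H) as H';
        clear H; rename H' into H; cbv beta in H
    end;
    clear HG; try (clear G; rename G' into G)
  end.

Tactic Notation "ointro" simple_intropattern(p) := extend; intros p; cbv beta in *; fold_eqn.

Tactic Notation "oinduction" constr(Q) :=
  match goal with
  | |- holds _ ?G => refine (@induction_definable Q G _ _ _)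
  | |- forall _, holds _ ?G => apply (@induction_definable Q G)
  | |- forall _, eqn ?G _ _ => apply (@induction_definable Q G)
  end; [dfn | cbv beta; fold_eqn | extend; let n := fresh "n" in let IH := fresh "IH" in
        intros n IH; cbv beta in *; fold_eqn].

Ltac osplit := split; fold_eqn.

Tactic Notation "oexists" uconstr(t) := apply (@exI _ t); cbv beta; fold_eqn.

Lemma succ_neq0 G x : eqn G (succ x) zero -> G ||- oBot.
Proof.
  exact (impE (@sem_axiom NVar FVar _ G Ax_succ_neq0 x)).
Qed.

Lemma succ_inj G x y : eqn G (succ x) (succ y) -> eqn G x y.
Proof. exact (impE (@sem_axiom NVar FVar _ G Ax_succ_inj x y)). Qed.

Lemma zero_or_succ G x : G ||- x == zero \/ exN y, x == succ y.
Proof.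
  revert x. oinduction (fun x => x == zero \/ exN y, x == succ y)%o.
  - apply orI1. apply R_eqN_refl.
  - apply orI2. oexists n. reflexivity.
Qed.

Ltac contra :=
  apply botE;
  match goal with
  | H : eqn ?G _ _ |- _ =>
    eapply (@succ_neq0 G);
    first [ exact H
          | etransitivity; [symmetry; exact H|]; assumption || reflexivity
          | etransitivity; [exact H|]; assumption || reflexivity ]
  end.

Tactic Notation "oor" constr(H) "as" simple_intropattern(p) simple_intropattern(q) :=
  apply (orE H); [ointro p | ointro q].

Tactic Notation "oex" constr(H) "as" simple_intropattern(x) simple_intropattern(p) :=
  apply (exE H); extend; intros x p; cbv beta in *; fold_eqn.

Tactic Notation "ocase" constr(t) "as" simple_intropattern(y) simple_intropattern(H) :=
  match goal with
  | |- holds _ ?G => apply (orE (@zero_or_succ G t))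
  | |- eqn ?G _ _ => apply (orE (@zero_or_succ G t))
  end;
  [ ointro H
  | let E := fresh "E" in ointro E; apply (exE E); extend; intros y H; clear E;
    cbv beta in *; fold_eqn ].

(** * Arithmetic *)

Lemma add_0_r G n : eqn G (add n zero) n.
Proof.
  revert n. oinduction (fun n => add n zero == n)%o.
  - apply add_0_l.
  - now rewrite add_S_l, IH.
Qed.

Lemma add_S_r G m n : eqn G (add m (succ n)) (succ (add m n)).
Proof.
  revert m. oinduction (fun m => add m (succ n) == succ (add m n))%o.
  - now rewrite !add_0_l.
  - now rewrite !add_S_l, IH.
Qed.

Lemma add_comm G m n : eqn G (add m n) (add n m).
Proof.
  revert m. oinduction (fun m => add m n == add n m)%o.
  - now rewrite add_0_l, add_0_r.
  - now rewrite add_S_l, add_S_r, IH.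
Qed.

Lemma add_assoc G m n k : eqn G (add m (add n k)) (add (add m n) k).
Proof.
  revert m. oinduction (fun m => add m (add n k) == add (add m n) k)%o.
  - now rewrite !add_0_l.
  - now rewrite !add_S_l, IH.
Qed.

Lemma add_eq0 G m n : eqn G (add m n) zero -> eqn G m zero /\ eqn G n zero.
Proof.
  intros H.
  assert (A : G ||- m == zero /\ n == zero); [|exact A].
  ocase m as y E.
  - osplit; [exact E|]. rewrite <- H, E. symmetry. apply add_0_l.
  - rewrite E, add_S_l in H. contra.
Qed.

Lemma sub_0_l G n : eqn G (sub zero n) zero.
Proof.
  revert n. oinduction (fun n => sub zero n == zero)%o.
  - apply sub_0_r.
  - now rewrite sub_S_r, IH, pred_0.
Qed.

Lemma sub_SS G m n : eqn G (sub (succ m) (succ n)) (sub m n).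
Proof.
  revert n. oinduction (fun n => sub (succ m) (succ n) == sub m n)%o.
  - now rewrite sub_S_r, !sub_0_r, pred_S.
  - now rewrite sub_S_r, IH, sub_S_r.
Qed.

Lemma sub_add G m n : eqn G (sub (add n m) n) m.
Proof.
  revert n. oinduction (fun n => sub (add n m) n == m)%o.
  - now rewrite add_0_l, sub_0_r.
  - now rewrite add_S_l, sub_SS.
Qed.

Lemma sub_diag G n : eqn G (sub n n) zero.
Proof. rewrite <- (add_0_r G n) at 1. apply sub_add. Qed.

Lemma dist_refl G n : eqn G (dist n n) zero.
Proof. unfold dist. now rewrite sub_diag, add_0_l. Qed.

Lemma sub_eq0_le G m n : eqn G (sub m n) zero -> G ||- exN k, add m k == n.
Proof.
  assert (A : G ||- forN n, sub m n == zero -> exN k, add m k == n).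
  { revert m. oinduction (fun m => forN n, sub m n == zero -> exN k, add m k == n)%o.
    - intros j. ointro _. oexists j. apply add_0_l.
    - intros j. ointro H. ocase j as y E.
      + rewrite E, sub_0_r in H. contra.
      + rewrite E, sub_SS in H. oex (impE (IH y) H) as k Hk. oexists k.
        now rewrite add_S_l, Hk, E. }
  exact (impE (A n)).
Qed.

Lemma dist_eq0 G m n : eqn G (dist m n) zero -> eqn G m n.
Proof.
  unfold dist. intros [H1 H2]%add_eq0.
  oex (sub_eq0_le H1) as k Hk.
  rewrite <- Hk, sub_add in H2. rewrite <- Hk, H2, add_0_r. reflexivity.
Qed.

Lemma sub_add_r G m n : eqn G (sub m (add m n)) zero.
Proof.
  revert m. oinduction (fun m => sub m (add m n) == zero)%o.
  - apply sub_0_l.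
  - now rewrite add_S_l, sub_SS.
Qed.

Lemma sub_eq0_cases G m n : eqn G (sub m n) zero -> G ||- n == m \/ sub (succ m) n == zero.
Proof.
  intros H. oex (sub_eq0_le H) as k Hk. ocase k as j E.
  - apply orI1. fold_eqn. now rewrite <- Hk, E, add_0_r.
  - apply orI2. fold_eqn. rewrite <- Hk, E, add_S_r, <- add_S_l. apply sub_add_r.
Qed.

Lemma add_sub G m n : eqn G (sub m n) zero -> eqn G (add m (sub n m)) n.
Proof. intros H. oex (sub_eq0_le H) as k Hk. now rewrite <- Hk, sub_add. Qed.

Lemma add_succ_neq G x k : eqn G (add x (succ k)) x -> G ||- oBot.
Proof.
  intros H. apply (@succ_neq0 G k). rewrite <- (sub_add G (succ k) x), H. apply sub_diag.
Qed.

(** * Pairs and finite sequences *)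

(** This and the next two equations enumerate the plane along antidiagonals: [(m + 1, n)] is
    followed by [(m, n + 1)], and [(0, n)] by [(n + 1, 0)]. *)
Lemma pair_0_0 G : eqn G (pair zero zero) zero.
Proof. now rewrite pair_eq, add_0_r, add_0_r, tri_0. Qed.

Lemma pair_0_S G n : eqn G (pair (succ n) zero) (succ (pair zero n)).
Proof. rewrite !pair_eq, !add_0_r, add_0_l, tri_S, add_S_l. now rewrite (add_comm G n). Qed.

Lemma pair_S_S G m n : eqn G (pair m (succ n)) (succ (pair (succ m) n)).
Proof. now rewrite !pair_eq, !add_S_r, !add_S_l. Qed.

Lemma pair_surj G p : G ||- exN m, exN n, p == pair m n.
Proof.
  revert p. oinduction (fun p => exN m, exN n, p == pair m n)%o.
  - oexists zero. oexists zero. symmetry. apply pair_0_0.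
  - oex IH as m H. oex H as k Hk. clear H. ocase m as j E.
    + oexists (succ k). oexists zero. now rewrite pair_0_S, Hk, E.
    + oexists j. oexists (succ k). now rewrite pair_S_S, Hk, E.
Qed.

(** The distance from [pair m n + 1] to the next triangular number is [m], so the antidiagonal
    changes exactly when [m] is zero. *)
Lemma diag_succ_pair G m n : eqn G (diag (pair m n)) (add m n) ->
  eqn G (diag (succ (pair m n))) (ifz m (succ (add m n)) (add m n)).
Proof.
  intros H. rewrite diag_S, H, tri_S, add_S_l, sub_SS, pair_eq.
  rewrite (add_comm G (add m n) (tri _)), (add_comm G m n), add_assoc, sub_add.
  reflexivity.
Qed.

(** Induction on the antidiagonal [k] and, along it, on [n], in the order of the enumeration. *)
Lemma diag_pair G m n : eqn G (diag (pair m n)) (add m n).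
Proof.
  assert (A : G ||- forN k, forN n, forN m, add m n == k -> diag (pair m n) == k).
  { oinduction (fun k => forN n, forN m, add m n == k -> diag (pair m n) == k)%o.
    - intros j i. ointro H. apply add_eq0 in H as [Hi Hj].
      now rewrite Hi, Hj, pair_0_0, diag_0.
    - oinduction (fun n => forN m, add m n == succ n0 -> diag (pair m n) == succ n0)%o.
      + intros i. ointro H. rewrite add_0_r in H. rewrite H, pair_0_S.
        assert (D : eqn G (diag (pair zero n0)) (add zero n0)).
        { rewrite add_0_l. exact (impE (IH n0 zero) (add_0_l G n0)). }
        now rewrite (diag_succ_pair D), ifz_0, add_0_l.
      + intros i. ointro H. rewrite add_S_r, <- add_S_l in H. rewrite pair_S_S.
        assert (D : eqn G (diag (pair (succ i) n1)) (add (succ i) n1)).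
        { rewrite H. exact (impE (IH0 (succ i)) H). }
        now rewrite (diag_succ_pair D), ifz_S. }
  refine (impE (A (add m n) n m) _). fold_eqn. reflexivity.
Qed.

Lemma snd_pair G m n : eqn G (snd (pair m n)) n.
Proof. rewrite snd_eq, diag_pair, pair_eq. apply sub_add. Qed.

Lemma fst_pair G m n : eqn G (fst (pair m n)) m.
Proof. rewrite fst_eq, diag_pair, snd_pair, add_comm. apply sub_add. Qed.

Lemma pair_eta G p : eqn G (pair (fst p) (snd p)) p.
Proof.
  oex (@pair_surj G p) as m H. oex H as n E. now rewrite E, fst_pair, snd_pair.
Qed.

Definition push (s i : nterm) : nterm := succ (pair s i).
Definition pop (t : nterm) : nterm := fst (pred t).
Definition top (t : nterm) : nterm := snd (pred t).

#[export] Instance push_proper G : Proper (eqn G ==> eqn G ==> eqn G) push.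
Proof. intros s s' Hs t t' Ht. unfold push. now rewrite Hs, Ht. Qed.
#[export] Instance pop_proper G : Proper (eqn G ==> eqn G) pop.
Proof. intros s s' Hs. unfold pop. now rewrite Hs. Qed.
#[export] Instance top_proper G : Proper (eqn G ==> eqn G) top.
Proof. intros s s' Hs. unfold top. now rewrite Hs. Qed.

Lemma pop_push G s i : eqn G (pop (push s i)) s.
Proof. unfold pop, push. now rewrite pred_S, fst_pair. Qed.

Lemma top_push G s i : eqn G (top (push s i)) i.
Proof. unfold top, push. now rewrite pred_S, snd_pair. Qed.

Lemma push_eta G t : eqn G (push (pop (succ t)) (top (succ t))) (succ t).
Proof. unfold push, pop, top. now rewrite !pred_S, pair_eta. Qed.

Lemma pre_S G k x : eqn G (pre (succ k) x)
  (ifz (pred (pre k x)) zero (succ (pop (pred (pre k x))))).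
Proof. apply pre_S_unfold. Qed.

Lemma pre_pop G k x s i :
  eqn G (pre k x) (succ (push s i)) -> eqn G (pre (succ k) x) (succ s).
Proof. intros H. rewrite pre_S, H, pred_S, pop_push. unfold push. apply ifz_S. Qed.

(** A nonzero value at [succ k] excludes both failure and the empty sequence at [k], so the sequence
    found there splits by [push_eta]. *)
Lemma pre_S_inv G k x s : eqn G (pre (succ k) x) (succ s) ->
  eqn G (pre k x) (succ (push s (top (pred (pre k x))))).
Proof.
  intros H. rewrite pre_S in H. ocase (pre k x) as v E.
  - rewrite E, pred_0, ifz_0 in H. contra.
  - rewrite E, pred_S in H. ocase v as w F.
    + rewrite F, ifz_0 in H. contra.
    + rewrite F, ifz_S in H. apply succ_inj in H. rewrite <- H, E, pred_S, F, push_eta.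
      reflexivity.
Qed.

Lemma pre_S_push G k s i : eqn G (pre (succ k) (push s i)) (pre k s).
Proof.
  revert k. oinduction (fun k => pre (succ k) (push s i) == pre k s)%o.
  - rewrite pre_0. apply (@pre_pop _ _ _ _ i). apply pre_0.
  - rewrite (pre_S _ (succ n)), IH, <- pre_S. reflexivity.
Qed.

Lemma pre_S_0 G k : eqn G (pre (succ k) zero) zero.
Proof.
  revert k. oinduction (fun k => pre (succ k) zero == zero)%o.
  - rewrite pre_S, pre_0, pred_S. apply ifz_0.
  - rewrite pre_S, IH, pred_0. apply ifz_0.
Qed.

Lemma le_tri G n : G ||- exN k, tri n == add n k.
Proof.
  ocase n as m E.
  - oexists zero. now rewrite E, tri_0, add_0_l.
  - oexists (tri m). now rewrite E, tri_S.
Qed.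

Lemma fst_le G p : G ||- exN k, p == add (fst p) k.
Proof.
  oex (@le_tri G (add (fst p) (snd p))) as k Hk.
  oexists (add (add (snd p) k) (snd p)).
  rewrite <- (pair_eta G p) at 1. rewrite pair_eq, Hk, !add_assoc. reflexivity.
Qed.

(** Course-of-values induction, phrased with a bound [n] on [x]: removing the last entry of a
    nonempty code gives a smaller code, by [fst_le]. *)
Lemma length_exists G x : G ||- exN k, pre k x == succ zero.
Proof.
  assert (A : G ||- forN n, forN x, forN d, add x d == n -> exN k, pre k x == succ zero).
  { oinduction (fun n => forN x, forN d, add x d == n -> exN k, pre k x == succ zero)%o.
    - intros y d. ointro H. apply add_eq0 in H as [Hy _]. oexists zero.
      now rewrite Hy, pre_0.
    - intros y d. ointro H. ocase y as p E.
      + oexists zero. now rewrite E, pre_0.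
      + oex (@fst_le G p) as k Hk.
        assert (F : G ||- exN k, pre k (fst p) == succ zero).
        { refine (impE (IH (fst p) (add k d)) _). fold_eqn.
          rewrite E, add_S_l in H. apply succ_inj in H.
          now rewrite add_assoc, <- Hk. }
        oex F as j Hj. oexists (succ j).
        rewrite E, <- (push_eta G p), pre_S_push. unfold pop. now rewrite pred_S. }
  refine (impE (A x x zero) _). apply add_0_r.
Qed.

(** * Comprehension for functions *)

Import Vector.VectorNotations.

(** As function terms have no abstraction, comprehension for [f] is an existential statement,
    demanded in every context. Congruence is included because [f] is an arbitrary Rocq function on
    terms. *)
Definition expressible (f : nterm -> nterm) : Prop :=
  (forall G s t, eqn G s t -> eqn G (f s) (f t)) /\
  forall G, G ||- exF c, forN n, NApp c n == f n.

Lemma composition G a b : G ||- exF c, forN n, NApp c n == NApp a (NApp b n).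
Proof. exact (@sem_axiom NVar FVar _ G Ax_composition a b). Qed.

Lemma recursion_unary G a b : G ||- exF c, forN m, forN n,
  NApp c (pair m zero) == NApp a m /\
  NApp c (pair m (succ n)) == NApp b (pair (pair m n) (NApp c (pair m n))).
Proof. exact (@sem_axiom NVar FVar _ G Ax_recursion a b). Qed.

Lemma search_unary G a : (G ||- forN m, exN n, NApp a (pair m n) == zero) ->
  G ||- exF c, forN m, NApp a (pair m (NApp c m)) == zero.
Proof. exact (impE (@sem_axiom NVar FVar _ G Ax_search a)). Qed.

Lemma express_id : expressible (fun n => n).
Proof.
  split; [auto|]. intros G. oexists (FPr (PProj Fin.F1)). intros n. apply (app_const G).
Qed.

(** [v] may be an open term, so in general no constant denotes this function; induction inside BIM
    builds it by composing with the successor. *)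
Lemma express_const v : expressible (fun _ => v).
Proof.
  split; [intros; fold_eqn; reflexivity|]. intros G. revert v.
  oinduction (fun v => exF c, forN n, NApp c n == v)%o.
  - oexists (FPr (PComp PZero [])). intros n. apply (app_const G).
  - oex IH as c Hc. oex (@composition G (FPr PSucc) c) as d Hd. oexists d. intros m.
    fold_eqn. rewrite (Hd m : eqn G _ _), (Hc m : eqn G _ _). apply (app_const G).
Qed.

Lemma express_app a f : expressible f -> expressible (fun n => NApp a (f n)).
Proof.
  intros [Hf Ef]. split.
  - intros G s t H. now rewrite (Hf G s t H).
  - intros G. oex (Ef G) as c Hc. oex (@composition G a c) as d Hd. oexists d. intros n.
    fold_eqn. rewrite (Hd n : eqn G _ _), (Hc n : eqn G _ _). reflexivity.
Qed.

Lemma express_eq f g : (forall G n, eqn G (f n) (g n)) -> expressible f -> expressible g.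
Proof.
  intros E [Hf Ef]. split.
  - intros G s t H. rewrite <- !E. now apply Hf.
  - intros G. oex (Ef G) as c Hc. oexists c. intros n. fold_eqn. rewrite <- E. apply Hc.
Qed.

Lemma express_pr1 (g : prf 1) f : expressible f -> expressible (fun n => NPr g [f n]).
Proof.
  intros Hf. apply (@express_eq (fun n => NApp (FPr g) (f n))); [|now apply express_app].
  intros G n. rewrite app_const, <- unfold_pr_eq. reflexivity.
Qed.

Lemma express_comp f g : expressible f -> expressible g -> expressible (fun n => f (g n)).
Proof.
  intros [Hf Ef] [Hg Eg]. split.
  - intros G s t H. apply Hf, Hg, H.
  - intros G. oex (Ef G) as c Hc. oex (Eg G) as d Hd.
    oex (@composition G c d) as e He. oexists e. intros n. fold_eqn.
    rewrite (He n : eqn G _ _), (Hc _ : eqn G _ _). apply Hf, Hd.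
Qed.

Lemma app_const_comp2 G (g : prf 2) h1 h2 t :
  eqn G (NApp (FPr (PComp g [h1; h2])) t) (NPr g [NPr h1 [t]; NPr h2 [t]]).
Proof.
  transitivity (NPr (PComp g [h1; h2]) [t]); [apply R_ax, Ax_const|].
  exact (R_ax G (Ax_comp g [h1; h2] [t])).
Qed.

(* [ax_recursion] yields terms with one call of a given function; that several
   functions can be called in one term is not an axiom ([express_pair]). *)
Lemma express_one_call a (q : prf 2) : expressible (fun n => NPr q [n; NApp a (fst n)]).
Proof.
  split.
  { intros G s t H. apply npr_congr.
    repeat (apply Vector.Forall2_cons; [now rewrite H|]). apply Vector.Forall2_nil. }
  intros G.
  oex (@composition G a (FPr pr_fst)) as a' Ha.
  (* One step of recursion suffices: [c (n, 0) = a (fst n)] and [c (n, 1) = q (n, c (n, 0))]; the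
     result is read off at [(n, 1)]. *)
  oex (@recursion_unary G a' (FPr (PComp q [PComp pr_fst [pr_fst]; pr_snd]))) as c Hc.
  oex (@composition G c (FPr (PComp pr_pair [PProj Fin.F1; PComp PSucc [PComp PZero []]]))) as d Hd.
  oexists d. intros n. fold_eqn. destruct (Hc n zero) as [H0 H1]. fold_eqn.
  assert (P : eqn G (NPr (PProj Fin.F1) [n]) n) by apply (unfold_pr_eq G (PProj Fin.F1)).
  assert (S : eqn G (NPr (PComp PSucc [PComp PZero []]) [n]) (succ zero))
    by apply (unfold_pr_eq G (PComp PSucc [PComp PZero []])).
  rewrite (Hd n : eqn G _ _), app_const_comp2.
  change (NPr pr_pair [?x; ?y]) with (pair x y). rewrite P, S, H1, app_const_comp2.
  apply npr_congr. repeat apply Vector.Forall2_cons; [| |apply Vector.Forall2_nil].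
  - transitivity (fst (fst (pair (pair n zero) (NApp c (pair n zero))))).
    + exact (R_ax G (Ax_comp pr_fst [pr_fst] [_])).
    + now rewrite !fst_pair.
  - change (NPr pr_snd [?x]) with (snd x).
    rewrite snd_pair, H0, (Ha n : eqn G _ _). apply app_proper.
    apply R_ax, Ax_const.
Qed.

Section Pairing_search.
Let x0 : prf 2 := PProj Fin.F1.
Let x1 : prf 2 := PProj (Fin.FS Fin.F1).
Let pr_dist : prf 2 := PComp pr_add [PComp pr_rsub [x1; x0]; PComp pr_rsub [x0; x1]].
Let pr_fst2 : prf 2 := PComp pr_fst [PComp pr_snd [x0]].
Let pr_snd2 : prf 2 := PComp pr_snd [PComp pr_snd [x0]].

(** This and [express_compare2] are the two stages of the function searched in [express_pair]. With
    [n = (m, p)], the first compares one function at [m] with [fst p] and passes on [m], [snd p] and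
    the result; the second compares the other function with [snd p] and adds. Each stage calls only
    one function. *)
Lemma express_compare1 a :
  expressible (fun n => pair (fst n) (pair (snd (snd n)) (dist (NApp a (fst n)) (fst (snd n))))).
Proof.
  set (q := PComp pr_pair
    [PComp pr_fst [x0]; PComp pr_pair [pr_snd2; PComp pr_dist [x1; pr_fst2]]]).
  assert (E : forall G n v, eqn G (NPr q [n; v])
      (pair (fst n) (pair (snd (snd n)) (dist v (fst (snd n)))))).
  { intros G n v. rewrite !pair_eq, !fst_eq, !snd_eq. apply unfold_pr_eq. }
  exact (express_eq (fun G n => E G n _) (express_one_call a q)).
Qed.

Lemma express_compare2 a :
  expressible (fun n => add (dist (NApp a (fst n)) (fst (snd n))) (snd (snd n))).
Proof.
  set (q := PComp pr_add [PComp pr_dist [x1; pr_fst2]; pr_snd2]).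
  assert (E : forall G n v, eqn G (NPr q [n; v]) (add (dist v (fst (snd n))) (snd (snd n)))).
  { intros G n v. rewrite !fst_eq, !snd_eq. apply unfold_pr_eq. }
  exact (express_eq (fun G n => E G n _) (express_one_call a q)).
Qed.
End Pairing_search.

(* [pair (f n) (g n)] is found by search: it is the unique zero of
   [p |-> dist (f n) (fst p) + dist (g n) (snd p)]. *)
Lemma express_pair f g : expressible f -> expressible g ->
  expressible (fun n => pair (f n) (g n)).
Proof.
  intros [Hf Ef] [Hg Eg]. split.
  { intros G s t H. now rewrite (Hf G s t H), (Hg G s t H). }
  intros G. oex (Ef G) as a Ha. oex (Eg G) as b Hb.
  oex (proj2 (express_comp (express_compare2 b) (express_compare1 a)) G) as c Hc.
  assert (V : forall m p, eqn G (NApp c (pair m p))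
    (add (dist (g m) (snd p)) (dist (f m) (fst p)))).
  { intros m p. rewrite (Hc _ : eqn G _ _), !snd_pair, !fst_pair, ?snd_pair, ?fst_pair.
    now rewrite (Ha m : eqn G _ _), (Hb m : eqn G _ _). }
  clear Hc.
  assert (T : G ||- forN m, exN n, NApp c (pair m n) == zero).
  { intros m. oexists (pair (f m) (g m)).
    now rewrite V, fst_pair, snd_pair, !dist_refl, add_0_l. }
  oex (search_unary T) as d Hd. oexists d. intros m. fold_eqn.
  pose proof (Hd m : eqn G _ _) as K. rewrite V in K. apply add_eq0 in K as [K1 K2].
  apply dist_eq0 in K1, K2. now rewrite K1, K2, pair_eta.
Qed.

Lemma express_pr2 (q : prf 2) f g : expressible f -> expressible g ->
  expressible (fun n => NPr q [f n; g n]).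
Proof.
  intros Hf Hg. refine (express_eq _ (express_app (FPr (PComp q [pr_fst; pr_snd]))
    (express_pair Hf Hg))).
  intros G n. rewrite app_const_comp2. apply npr_congr.
  repeat apply Vector.Forall2_cons; [| |apply Vector.Forall2_nil].
  - apply fst_pair.
  - apply snd_pair.
Qed.

Lemma express_pr3 (q : prf 3) f g h : expressible f -> expressible g -> expressible h ->
  expressible (fun n => NPr q [f n; g n; h n]).
Proof.
  intros Hf Hg Hh.
  set (hs := [pr_fst; PComp pr_fst [pr_snd]; PComp pr_snd [pr_snd]]).
  refine (express_eq _ (express_app (FPr (PComp q hs)) (express_pair Hf (express_pair Hg Hh)))).
  intros G n. set (w := pair _ _).
  transitivity (NPr (PComp q hs) [w]); [apply R_ax, Ax_const|].
  transitivity (NPr q (Vector.map (fun h => NPr h [w]) hs)); [apply R_ax, Ax_comp|].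
  apply npr_congr. repeat apply Vector.Forall2_cons; [| | |apply Vector.Forall2_nil].
  - apply fst_pair.
  - transitivity (fst (snd w)); [exact (R_ax G (Ax_comp pr_fst [pr_snd] [w]))|].
    unfold w. now rewrite snd_pair, fst_pair.
  - transitivity (snd (snd w)); [exact (R_ax G (Ax_comp pr_snd [pr_snd] [w]))|].
    unfold w. now rewrite !snd_pair.
Qed.

Ltac express :=
  cbv beta;
  first [ assumption | apply express_const | apply express_id
        | apply express_app; express | apply express_pr1; express
        | apply express_pr2; express | apply express_pr3; express ].

Definition proper2 (f : nterm -> nterm -> nterm) : Prop :=
  forall G, Proper (eqn G ==> eqn G ==> eqn G) f.

Ltac solve_proper2 :=
  let H := fresh in let K := fresh in
  intros ? ? ? H ? ? K; cbv beta; rewrite ?H, ?K; reflexivity.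

Lemma recursion_expressible f G u : proper2 f -> expressible (fun w => f (fst w) (snd w)) ->
  G ||- exF c, NApp c zero == u /\ forN n, NApp c (succ n) == f n (NApp c n).
Proof.
  intros Hf Ef.
  assert (E : expressible (fun w => f (snd (fst w)) (snd w))).
  { refine (express_eq _ (express_comp Ef (_ : expressible (fun w => pair (snd (fst w)) (snd w)))));
      [|express].
    intros G' w. apply Hf; [apply fst_pair|apply snd_pair]. }
  oex (proj2 E G) as b Hb. oex (proj2 (express_const u) G) as a Ha.
  oex (@recursion_unary G a b) as c Hc.
  assert (D : expressible (fun n => NApp c (pair zero n))) by express.
  oex (proj2 D G) as d Hd. clear E D. oexists d. osplit.
  - rewrite (Hd _ : eqn G _ _), <- (Ha zero : eqn G _ _). apply (Hc zero zero).
  - intros n. fold_eqn. rewrite (Hd (succ n) : eqn G _ _). destruct (Hc zero n) as [_ H]. fold_eqn.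
    rewrite H, (Hb _ : eqn G _ _). apply Hf; [now rewrite fst_pair, snd_pair|].
    rewrite snd_pair. symmetry. apply Hd.
Qed.

(** The form in which countable choice is used from here on: only for relations decided by an
    expression. *)
Lemma search_expressible f G : proper2 f -> expressible (fun w => f (fst w) (snd w)) ->
  (G ||- forN m, exN n, f m n == zero) -> G ||- exF c, forN m, f m (NApp c m) == zero.
Proof.
  intros Hf Ef H. oex (proj2 Ef G) as a Ha.
  assert (E : forall m n, eqn G (NApp a (pair m n)) (f m n)).
  { intros m n. rewrite (Ha _ : eqn G _ _). apply Hf; [apply fst_pair|apply snd_pair]. }
  clear Ha.
  assert (T : G ||- forN m, exN n, NApp a (pair m n) == zero).
  { intros m. oex (H m) as n Hn. oexists n. now rewrite E. }
  oex (search_unary T) as c Hc. oexists c. intros m. fold_eqn. rewrite <- E. apply Hc.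
Qed.

(** * Almost-finiteness along a sequence *)

Lemma neq0_succ G x : (G ||- x =/= zero) -> eqn G x (succ (pred x)).
Proof.
  intros H. ocase x as y E.
  - apply botE. exact (impE H E).
  - now rewrite E, pred_S.
Qed.

Lemma succ_neq_zero G x y : eqn G x (succ y) -> G ||- x =/= zero.
Proof. intros H. ointro E. rewrite E in H. contra. Qed.

Lemma neq0_eqn G x y : eqn G x y -> (G ||- x =/= zero) -> G ||- y =/= zero.
Proof. intros E H%neq0_succ. rewrite E in H at 1. exact (succ_neq_zero H). Qed.

(** This and the next predicates follow the notions of the statement connective by connective, so as
    to be convertible with their [sem]. *)
Definition oCat (s : nterm) (g : fterm) (n t : nterm) : oprop :=
  (exF c, NApp c zero == s /\
     ((forN i, NApp c (succ i) == push (NApp c i) (NApp g i)) /\ NApp c n == t))%o.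

Definition oLess (x y : nterm) : oprop := (exN k, add x (succ k) == y)%o.

Definition oIncreasing (z : fterm) : oprop :=
  (forN n, oLess (NApp z n) (NApp z (succ n)))%o.

Definition oSpread (b : fterm) : oprop :=
  (forN s, (NApp b s == zero -> exN n, NApp b (push s n) == zero) /\
           ((exN n, NApp b (push s n) == zero) -> NApp b s == zero))%o.

Definition oThin (a : fterm) : oprop :=
  (forN s, forN t, ((NApp a s =/= zero /\ NApp a t =/= zero) /\
     exF g, exN n, oCat s g n t) -> s == t)%o.

Lemma path_exists G s g : G ||- exF c, NApp c zero == s /\
  forN i, NApp c (succ i) == push (NApp c i) (NApp g i).
Proof.
  apply (@recursion_expressible (fun n v => push v (NApp g n))); [solve_proper2|express].
Qed.

(** [g] reads the entries of [x] after [s] from the left: the [i]-th is the last one remaining once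
    [k - (i + 1)] entries are removed. The invariant is that [c i] is [x] without its last [k - i]
    entries. *)
Lemma pre_path G c g k x s :
  eqn G (NApp c zero) s ->
  (forall i, eqn G (NApp c (succ i)) (push (NApp c i) (NApp g i))) ->
  (forall i, eqn G (NApp g i) (top (pred (pre (sub k (succ i)) x)))) ->
  eqn G (pre k x) (succ s) -> eqn G (NApp c k) x.
Proof.
  intros H0 HS Hg Hk.
  assert (A : G ||- forN i, forN j, add i j == k -> pre j x == succ (NApp c i)).
  { oinduction (fun i => forN j, add i j == k -> pre j x == succ (NApp c i))%o.
    - intros j. ointro E. rewrite add_0_l in E. now rewrite E, H0.
    - intros j. ointro E.
      assert (E' : eqn G (add n (succ j)) k) by (rewrite add_S_r, <- add_S_l; exact E).
      pose proof (impE (IH (succ j)) E' : eqn G _ _) as P. apply pre_S_inv in P.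
      now rewrite P, HS, Hg, <- E, add_S_l, sub_SS, sub_add. }
  pose proof (impE (A k zero) (add_0_r G k) : eqn G _ _) as P.
  rewrite pre_0 in P. symmetry. exact (succ_inj P).
Qed.

(** Links the decidable relation given by [pre] to the initial-part relation in the definition of
    thinness, which quantifies over functions. *)
Lemma pre_initial G k x s : eqn G (pre k x) (succ s) -> G ||- exF g, exN n, oCat s g n x.
Proof.
  intros H.
  assert (E : expressible (fun i => top (pred (pre (sub k (succ i)) x)))) by express.
  oex (proj2 E G) as g Hg. clear E. oex (@path_exists G s g) as c Hc.
  oexists g. oexists k. oexists c. destruct Hc as [H0 HS]. fold_eqn.
  osplit; [exact H0|]. osplit; [exact HS|]. exact (pre_path H0 HS Hg H).
Qed.

Lemma pre_spread G b k x : (G ||- oSpread b) -> eqn G (NApp b x) zero ->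
  forall s, eqn G (pre k x) (succ s) -> eqn G (NApp b s) zero.
Proof.
  intros Hb Hx.
  assert (A : G ||- forN k, forN s, pre k x == succ s -> NApp b s == zero).
  { oinduction (fun k => forN s, pre k x == succ s -> NApp b s == zero)%o.
    - intros s. ointro E. rewrite pre_0 in E. now rewrite <- (succ_inj E).
    - intros s. ointro E. apply pre_S_inv in E.
      refine (impE (proj2 (Hb s)) _). oexists (top (pred (pre n x))). exact (impE (IH _) E). }
  intros s E. exact (impE (A k s) E).
Qed.

Lemma path_length G c g :
  eqn G (NApp c zero) zero ->
  (forall i, eqn G (NApp c (succ i)) (push (NApp c i) (NApp g i))) ->
  forall n k, eqn G (pre k (NApp c n)) (succ zero) -> eqn G k n.
Proof.
  intros H0 HS.
  assert (A : G ||- forN n, forN k, pre k (NApp c n) == succ zero -> k == n).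
  { oinduction (fun n => forN k, pre k (NApp c n) == succ zero -> k == n)%o.
    - intros k. ointro E. ocase k as j F; [exact F|]. rewrite F, H0, pre_S_0 in E. contra.
    - intros k. ointro E. ocase k as j F.
      + rewrite F, pre_0, HS in E. apply succ_inj in E. unfold push in E. contra.
      + rewrite F, HS, pre_S_push in E. now rewrite F, (impE (IH j) E : eqn G _ _). }
  intros n k E. exact (impE (A n k) E).
Qed.

Lemma path_unique G c d s g :
  eqn G (NApp c zero) s ->
  (forall i, eqn G (NApp c (succ i)) (push (NApp c i) (NApp g i))) ->
  eqn G (NApp d zero) s ->
  (forall i, eqn G (NApp d (succ i)) (push (NApp d i) (NApp g i))) ->
  forall n, eqn G (NApp c n) (NApp d n).
Proof.
  intros Hc0 HcS Hd0 HdS. oinduction (fun n => NApp c n == NApp d n)%o.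
  - now rewrite Hc0, Hd0.
  - now rewrite HcS, HdS, IH.
Qed.

Lemma thin_eq G a k s x : (G ||- oThin a) ->
  (G ||- NApp a s =/= zero) -> (G ||- NApp a x =/= zero) ->
  eqn G (pre k x) (succ s) -> eqn G s x.
Proof.
  intros H Hs Hx E. refine (impE (H s x) _). osplit; [split; assumption|].
  exact (pre_initial E).
Qed.

Lemma increasing_less G z e j : (G ||- oIncreasing z) ->
  G ||- oLess (NApp z e) (NApp z (add (succ e) j)).
Proof.
  intros H. revert j. oinduction (fun j => oLess (NApp z e) (NApp z (add (succ e) j)))%o.
  - oex (H e) as k Hk. oexists k. now rewrite add_0_r.
  - oex IH as k Hk. oex (H (add (succ e) n)) as j Hj.
    oexists (add (succ k) j).
    rewrite (add_S_r G (succ e) n), <- Hj, <- Hk, <- (add_S_r G (succ k) j).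
    apply add_assoc.
Qed.

(* [0] iff the [e]-th term of [z] is in the bar and extends [s] by [k] entries *)
Definition miss (a z : fterm) (s e k : nterm) : nterm :=
  ifz (NApp a (NApp z e)) (succ zero) (dist (pre k (NApp z e)) (succ s)).

#[export] Instance miss_proper G a z :
  Proper (eqn G ==> eqn G ==> eqn G ==> eqn G) (miss a z).
Proof. intros s s' Hs e e' He k k' Hk. unfold miss. now rewrite Hs, He, Hk. Qed.

Lemma miss_0 G a z s e k : eqn G (miss a z s e k) zero ->
  (G ||- NApp a (NApp z e) =/= zero) /\ eqn G (pre k (NApp z e)) (succ s).
Proof.
  intros H. change (G ||- NApp a (NApp z e) =/= zero /\ pre k (NApp z e) == succ s).
  unfold miss in H. ocase (NApp a (NApp z e)) as y E.
  - rewrite E, ifz_0 in H. contra.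
  - rewrite E, ifz_S in H. osplit; [exact (succ_neq_zero E)|]. exact (dist_eq0 H).
Qed.

Lemma miss_0_intro G a z s e k : (G ||- NApp a (NApp z e) =/= zero) ->
  eqn G (pre k (NApp z e)) (succ s) -> eqn G (miss a z s e k) zero.
Proof.
  intros H%neq0_succ E. unfold miss. rewrite H, ifz_S, E. apply dist_refl.
Qed.

(* The members of the bar that extend [s] are almost-finite along [z]: no [g]
   provides, for each [n], the index of such a term of [z] beyond [n]. *)
Definition oAlmostFinite (a z : fterm) (s : nterm) : oprop :=
  (forF g, exN n, miss a z s (add n (fst (NApp g n))) (snd (NApp g n)) =/= zero)%o.

(** * Nodes with almost-finite part of the bar *)

Section Almost_finite.
Variables (a b z : fterm).

(** By thinness a term of [z] that meets the conditions equals [s], and an increasing [z] takes this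
    value at most once. Asking [g] at [succ e0] makes the second index [e1] exceed [e0], so one of
    the two proposals fails. *)
Lemma almost_finite_bar G s : (G ||- oThin a) -> (G ||- oIncreasing z) ->
  (G ||- NApp a s =/= zero) -> G ||- oAlmostFinite a z s.
Proof.
  intros Ht Hz Hs g.
  set (e0 := add zero (fst (NApp g zero))).
  set (e1 := add (succ e0) (fst (NApp g (succ e0)))).
  ocase (miss a z s e0 (snd (NApp g zero))) as y E.
  - ocase (miss a z s e1 (snd (NApp g (succ e0)))) as y F.
    + apply miss_0 in E as [E1 E2], F as [F1 F2].
      apply (thin_eq Ht Hs E1) in E2. apply (thin_eq Ht Hs F1) in F2.
      apply botE. oex (@increasing_less G z e0 (fst (NApp g (succ e0))) Hz) as k Hk.
      apply (@add_succ_neq G (NApp z e0) k). rewrite Hk, <- E2. exact (symmetry F2).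
    + oexists (succ e0). exact (succ_neq_zero F).
  - oexists zero. exact (succ_neq_zero E).
Qed.

Lemma almost_finite_empty G s : (G ||- oSpread b) ->
  (G ||- forN s, NApp a s =/= zero -> NApp b s == zero) ->
  (G ||- NApp b s =/= zero) -> G ||- oAlmostFinite a z s.
Proof.
  intros Hb Hab Hs g. oexists zero. ointro E. apply miss_0 in E as [E1 E2].
  refine (impE Hs _). refine (pre_spread Hb _ E2). exact (impE (Hab _) E1).
Qed.

(** Extending [s * <i>] by [k] entries is a way of extending [s] by [k + 1]. This direction is
    needed because the hypothesis of bar induction is an equivalence. *)
Lemma almost_finite_push G s i :
  (G ||- oAlmostFinite a z s) -> G ||- oAlmostFinite a z (push s i).
Proof.
  intros H g.
  assert (E : expressible (fun n => pair (fst (NApp g n)) (succ (snd (NApp g n))))) by express.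
  oex (proj2 E G) as c Hc. clear E. oex (H c) as n Hn. oexists n. ointro E.
  apply miss_0 in E as [E1 E2]. refine (impE Hn _). fold_eqn.
  rewrite (Hc n : eqn G _ _), fst_pair, snd_pair. apply miss_0_intro; [exact E1|].
  exact (pre_pop E2).
Qed.

(* The first entry after [s] of the [e]-th term of [z], when that term extends
   [s] by [k] entries *)
Definition branch (e k : nterm) : nterm := top (pred (pre (pred k) (NApp z e))).

#[export] Instance branch_proper G : Proper (eqn G ==> eqn G ==> eqn G) branch.
Proof. intros e e' He k k' Hk. unfold branch. now rewrite He, Hk. Qed.

(** The term is in the bar and [s] is not, so [k] is positive and a first entry after [s] exists. *)
Lemma miss_branch G s e k : eqn G (NApp a s) zero -> eqn G (miss a z s e k) zero ->
  eqn G (miss a z (push s (branch e k)) e (pred k)) zero.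
Proof.
  intros Hs H. apply miss_0 in H as [H1 H2]. apply miss_0_intro; [exact H1|].
  ocase k as j E.
  - rewrite E, pre_0 in H2. apply succ_inj in H2. apply botE. refine (impE H1 _).
    fold_eqn. now rewrite H2.
  - unfold branch. rewrite E in H2. apply pre_S_inv in H2. now rewrite E, pred_S.
Qed.

(* [0] iff [(e, k)] is a miss for [s] or its branch is at least [m] *)
Definition beyond (s m e k : nterm) : nterm := ifz (miss a z s e k) (sub m (branch e k)) zero.

#[export] Instance beyond_proper G :
  Proper (eqn G ==> eqn G ==> eqn G ==> eqn G ==> eqn G) beyond.
Proof.
  intros s s' Hs m m' Hm e e' He k k' Hk. unfold beyond. now rewrite Hs, Hm, He, Hk.
Qed.

(** For the step from [m] to [m + 1], the hypothesis is applied to every shift of [g]: it chooses,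
    for each [j], an argument of [g] not below [j] whose proposal fails or branches at [m] or later.
    Almost-finiteness at [s * <m>] then selects a [j] for which the branch is not [m]. *)
Lemma beyond_all G s : eqn G (NApp a s) zero ->
  (G ||- forN i, oAlmostFinite a z (push s i)) ->
  G ||- forN m, forF g, exN n, beyond s m (add n (fst (NApp g n))) (snd (NApp g n)) == zero.
Proof.
  intros Hs H.
  oinduction (fun m => forF g, exN n,
    beyond s m (add n (fst (NApp g n))) (snd (NApp g n)) == zero)%o.
  - intros g. oexists zero. unfold beyond.
    ocase (miss a z s (add zero (fst (NApp g zero))) (snd (NApp g zero))) as y E.
    + rewrite E, ifz_0. apply sub_0_l.
    + now rewrite E, ifz_S.
  - rename n into m. intros g.
    set (f := fun j i => beyond s m (add (add j i) (fst (NApp g (add j i))))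
                                    (snd (NApp g (add j i)))).
    assert (T : G ||- forN j, exN i, f j i == zero).
    { intros j.
      (* The shift of [g] by [j]; the extra [j] in the first component makes the index proposed at
         [i] equal to the one [g] proposes at [j + i]. *)
      assert (E : expressible (fun i => pair (add j (fst (NApp g (add j i))))
                                             (snd (NApp g (add j i))))) by express.
      oex (proj2 E G) as c Hc. clear E. oex (IH c) as i Hi. oexists i. unfold f.
      rewrite (Hc i : eqn G _ _), fst_pair, snd_pair, add_assoc, (add_comm G i j) in Hi.
      exact Hi. }
    assert (F : G ||- exF w, forN j, f j (NApp w j) == zero).
    { apply search_expressible; [unfold f; solve_proper2|unfold f; express|exact T]. }
    clear T. oex F as w Hw. clear F. unfold f in Hw.
    (* At [j] this proposes the same index of [z] as [g] does at [j + w j], with one entry fewer,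
       since entries are now counted from [s * <m>]. *)
    assert (E : expressible (fun j =>
      pair (add (NApp w j) (fst (NApp g (add j (NApp w j)))))
           (pred (snd (NApp g (add j (NApp w j))))))) by express.
    oex (proj2 E G) as c Hc. clear E. oex (H m c) as j Hj.
    pose proof (Hw j : eqn G _ _) as Hb. clear Hw.
    oexists (add j (NApp w j)).
    pose proof (Hc j : eqn G _ _) as Hcj. clear Hc.
    assert (Hm : G ||- miss a z (push s m)
      (add (add j (NApp w j)) (fst (NApp g (add j (NApp w j)))))
      (pred (snd (NApp g (add j (NApp w j))))) =/= zero).
    { refine (neq0_eqn _ Hj). now rewrite Hcj, fst_pair, snd_pair, add_assoc. }
    clear Hj Hcj. set (n := add j (NApp w j)) in *. set (e := add n _) in *.
    set (k := snd (NApp g n)) in *. unfold beyond in Hb |- *.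
    ocase (miss a z s e k) as y E; [|now rewrite E, ifz_S].
    rewrite E, ifz_0 in Hb. rewrite E, ifz_0.
    (* A term branching exactly at [m] would extend [s * <m>], against the choice of [j]. *)
    oor (sub_eq0_cases Hb) as I I; [|exact I].
    apply botE. refine (impE Hm _). fold_eqn. rewrite <- I. exact (miss_branch Hs E).
Qed.

Lemma almost_finite_node G s : (G ||- oThin a) -> (G ||- oIncreasing z) ->
  (G ||- oSpread b) ->
  (G ||- forN s, forF z, oIncreasing z -> exN n, NApp b (push s (NApp z n)) =/= zero) ->
  (G ||- forN s, NApp a s =/= zero -> NApp b s == zero) ->
  (G ||- forN i, oAlmostFinite a z (push s i)) -> G ||- oAlmostFinite a z s.
Proof.
  intros Ht Hz Hb Hfan Hab H.
  ocase (NApp a s) as y Hs.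
  2:{ exact (almost_finite_bar Ht Hz (succ_neq_zero Hs)). }
  intros g.
  set (ix := fun n => add n (fst (NApp g n))). set (len := fun n => snd (NApp g n)).
  assert (F : G ||- exF w, forN m, beyond s m (ix (NApp w m)) (len (NApp w m)) == zero).
  { apply (@search_expressible (fun m n => beyond s m (ix n) (len n))).
    - unfold ix, len. solve_proper2.
    - unfold ix, len. express.
    - intros m. pose proof (beyond_all Hs H) as B. exact (B m g). }
  oex F as w Hw. clear F.
  (* The maximum of [m] and the branch of the proposal chosen for [m]. Thus [c] below increases
     unconditionally, and [next m] is the branch itself whenever the proposal does not fail. *)
  set (next := fun m => add m (sub (branch (ix (NApp w m)) (len (NApp w m))) m)).
  assert (F : G ||- exF c, NApp c zero == next zero /\
    forN n, NApp c (succ n) == next (succ (NApp c n))).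
  { apply (@recursion_expressible (fun _ v => next (succ v))).
    - unfold next, ix, len. solve_proper2.
    - unfold next, ix, len. express. }
  oex F as c Hc. clear F. destruct Hc as [Hc0 HcS]. fold_eqn.
  assert (I : G ||- oIncreasing c).
  { intros n. oexists (sub (branch (ix (NApp w (succ (NApp c n)))) (len (NApp w (succ (NApp c n)))))
                           (succ (NApp c n))).
    rewrite (HcS n : eqn G _ _). unfold next. now rewrite add_S_r, add_S_l. }
  oex (impE (Hfan s c) I) as n Hn.
  assert (M : G ||- exN m, NApp c n == next m).
  { ocase n as j E.
    - oexists zero. now rewrite E.
    - oexists (succ (NApp c j)). rewrite E. apply HcS. }
  (* If the proposal chosen for [m] succeeded, [s * <c n>] would be an initial part of a member of
     the bar, hence in the spread, which the choice of [n] excludes. *)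
  oex M as m Hm. oexists (NApp w m). ointro E.
  pose proof (Hw m : eqn G _ _) as B. unfold beyond in B.
  fold (ix (NApp w m)) (len (NApp w m)) in E. rewrite E, ifz_0 in B.
  apply add_sub in B. unfold next in Hm. rewrite B in Hm.
  apply (miss_branch Hs) in E. apply miss_0 in E as [E1 E2].
  refine (impE Hn _). fold_eqn. rewrite Hm.
  refine (pre_spread Hb _ E2). exact (impE (Hab _) E1).
Qed.
End Almost_finite.

(** * The co-analytic set of nodes *)

Definition oCA (c : fterm) (s : nterm) : oprop :=
  (forF g, exN n, exN t, oCat zero g n t /\ NApp c (pair s t) =/= zero)%o.

Section Coanalytic.
Variables (a z l : fterm).

(* With [l] the length function: nonzero iff the last entry of [t] and its
   position are a witness for [oAlmostFinite a z s] *)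
Definition witness (s t : nterm) : nterm :=
  ifz t zero (miss a z s (add (NApp l (pop t)) (fst (top t))) (snd (top t))).

#[export] Instance witness_proper G : Proper (eqn G ==> eqn G ==> eqn G) witness.
Proof. intros s s' Hs t t' Ht. unfold witness. now rewrite Hs, Ht. Qed.

Lemma witness_path G c g s n :
  (forall t, eqn G (pre (NApp l t) t) (succ zero)) ->
  eqn G (NApp c zero) zero ->
  (forall i, eqn G (NApp c (succ i)) (push (NApp c i) (NApp g i))) ->
  eqn G (witness s (NApp c (succ n)))
    (miss a z s (add n (fst (NApp g n))) (snd (NApp g n))).
Proof.
  intros Hl H0 HS. pose proof (path_length H0 HS (Hl (NApp c n))) as L.
  unfold witness. rewrite HS, pop_push, top_push, L. unfold push. now rewrite ifz_S.
Qed.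

Lemma CA_almost_finite G c s :
  (forall t, eqn G (pre (NApp l t) t) (succ zero)) ->
  (forall s t, eqn G (NApp c (pair s t)) (witness s t)) ->
  (G ||- oCA c s) -> G ||- oAlmostFinite a z s.
Proof.
  intros Hl Hc H g. oex (H g) as n H1. oex H1 as t H2. clear H1.
  destruct H2 as [H1 H2]. oex H1 as p Hp. clear H1. destruct Hp as [P0 [PS Pn]]. fold_eqn.
  apply (neq0_eqn (Hc s t)) in H2. ocase n as m E.
  - apply botE. refine (impE H2 _). fold_eqn. rewrite <- Pn, E, P0. apply ifz_0.
  - oexists m. refine (neq0_eqn _ H2). rewrite <- Pn, E. now apply witness_path.
Qed.

Lemma almost_finite_CA G c s :
  (forall t, eqn G (pre (NApp l t) t) (succ zero)) ->
  (forall s t, eqn G (NApp c (pair s t)) (witness s t)) ->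
  (G ||- oAlmostFinite a z s) -> G ||- oCA c s.
Proof.
  intros Hl Hc H g. oex (H g) as n Hn. oex (@path_exists G zero g) as p Hp.
  destruct Hp as [P0 PS]. fold_eqn. oexists (succ n). oexists (NApp p (succ n)). osplit.
  - oexists p. osplit; [exact P0|]. osplit; [exact PS|reflexivity].
  - refine (neq0_eqn _ Hn). rewrite Hc. symmetry. now apply witness_path.
Qed.
End Coanalytic.

(* The bar is only given in the spread, so [g] is first retracted onto it; a
   node of [g] off the spread has no extension in the bar. *)
Lemma bar_almost_finite G a b z g : (G ||- oThin a) -> (G ||- oIncreasing z) ->
  (G ||- oSpread b) ->
  (G ||- forN s, NApp a s =/= zero -> NApp b s == zero) ->
  (G ||- forF g, (forN n, exN t, oCat zero g n t /\ NApp b t == zero) ->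
     exN n, exN t, oCat zero g n t /\ NApp a t =/= zero) ->
  G ||- exN n, exN t, oCat zero g n t /\ oAlmostFinite a z t.
Proof.
  intros Ht Hz Hb Hab Hbar.
  assert (W : G ||- exF w, forN s, ifz (NApp b s) (NApp b (push s (NApp w s))) zero == zero).
  { apply (@search_expressible (fun s j => ifz (NApp b s) (NApp b (push s j)) zero));
      [solve_proper2|express|].
    intros s. ocase (NApp b s) as y E.
    - oex (impE (proj1 (Hb s)) E) as j Hj. oexists j. now rewrite E, ifz_0.
    - oexists zero. now rewrite E, ifz_S. }
  oex W as w Hw. clear W.
  (* The retraction follows [g] while this stays in the spread and otherwise takes the successor
     provided by [w]. *)
  set (next := fun n v => ifz (NApp b (push v (NApp g n))) (NApp g n) (NApp w v)).
  assert (R : G ||- exF c, NApp c zero == zero /\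
    forN n, NApp c (succ n) == push (NApp c n) (next n (NApp c n))).
  { apply (@recursion_expressible (fun n v => push v (next n v))); unfold next;
      [solve_proper2|express]. }
  oex R as c Hc. clear R. destruct Hc as [C0 CS]. fold_eqn.
  assert (E : expressible (fun n => next n (NApp c n))) by (unfold next; express).
  oex (proj2 E G) as d Hd. clear E.
  oex (@path_exists G zero g) as p Hp. destruct Hp as [P0 PS]. fold_eqn.
  assert (CatP : G ||- forN n, oCat zero g n (NApp p n)).
  { intros n. oexists p. osplit; [exact P0|]. osplit; [exact PS|reflexivity]. }
  (* If the empty sequence is already off the spread, there is nothing to retract onto and the root
     itself qualifies. *)
  ocase (NApp b zero) as y E.
  2:{ oexists zero. oexists (NApp p zero). osplit; [apply CatP|].
      apply (almost_finite_empty (z := z) Hb Hab).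
      refine (succ_neq_zero (y := y) _). now rewrite P0. }
  assert (B : G ||- forN n, NApp b (NApp c n) == zero).
  { oinduction (fun n => NApp b (NApp c n) == zero)%o.
    - now rewrite C0.
    - pose proof (Hw (NApp c n) : eqn G _ _) as V. cbv beta in V.
      rewrite IH, ifz_0 in V. rewrite (CS n : eqn G _ _). unfold next.
      ocase (NApp b (push (NApp c n) (NApp g n))) as j F.
      + now rewrite F, ifz_0.
      + now rewrite F, ifz_S. }
  assert (D : G ||- forN n, NApp c (succ n) == push (NApp c n) (NApp d n)).
  { intros n. fold_eqn. rewrite (Hd n : eqn G _ _). apply CS. }
  assert (M : G ||- forN n, exN t, oCat zero d n t /\ NApp b t == zero).
  { intros n. oexists (NApp c n). osplit; [|apply B].
    oexists c. osplit; [exact C0|]. osplit; [exact D|reflexivity]. }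
  oex (impE (Hbar d) M) as n H1. oex H1 as t H2. clear H1 M.
  destruct H2 as [H1 Hat]. oex H1 as e He. clear H1. destruct He as [E0 [ES En]]. fold_eqn.
  rewrite <- (path_unique C0 D E0 ES n) in En. clear E0 ES.
  (* The spread is closed under initial parts, so if [g] is still in the spread at [n], it has never
     been altered. *)
  assert (Q : G ||- forN n, NApp b (NApp p n) == zero -> NApp c n == NApp p n).
  { oinduction (fun n => NApp b (NApp p n) == zero -> NApp c n == NApp p n)%o.
    - ointro _. now rewrite C0, P0.
    - ointro F. rewrite (PS _ : eqn G _ _) in F.
      assert (Z : eqn G (NApp b (NApp p n0)) zero).
      { refine (impE (proj2 (Hb (NApp p n0))) _). oexists (NApp g n0). exact F. }
      pose proof (impE IH Z : eqn G _ _) as K.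
      rewrite (CS n0 : eqn G _ _), (PS n0 : eqn G _ _). unfold next.
      now rewrite K, F, ifz_0. }
  oexists n. oexists (NApp p n). osplit; [apply CatP|].
  ocase (NApp b (NApp p n)) as j F.
  - apply (almost_finite_bar Ht Hz). refine (neq0_eqn _ Hat).
    now rewrite <- En, (impE (Q n) F : eqn G _ _).
  - exact (almost_finite_empty Hb Hab (succ_neq_zero F)).
Qed.

(** * From bar induction to the almost-fan theorem *)

Definition oPi11_BI : oprop :=
  (forF c, ((forF g, exN n, exN t, oCat zero g n t /\ oCA c t) /\
     forN s, (oCA c s -> forN i, oCA c (push s i)) /\ ((forN i, oCA c (push s i)) -> oCA c s)) ->
     oCA c zero)%o.

Definition oAlmFT : oprop :=
  (forF b, forF a,
     ((oSpread b /\
       forN s, forF z, oIncreasing z -> exN n, NApp b (push s (NApp z n)) =/= zero) /\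
      ((forF g, (forN n, exN t, oCat zero g n t /\ NApp b t == zero) ->
          exN n, exN t, oCat zero g n t /\ NApp a t =/= zero) /\
       oThin a)) /\
     (forN s, NApp a s =/= zero -> NApp b s == zero) ->
     forF z, oIncreasing z -> exN n, NApp a (NApp z n) =/= zero -> oBot)%o.

Lemma almost_fan G : (G ||- oPi11_BI) -> G ||- oAlmFT.
Proof.
  intros BI b a. ointro H. destruct H as [[[Hb Hfan] [Hbar Ht]] Hab].
  intros z. ointro Hz.
  assert (L : G ||- exF l, forN t, dist (pre (NApp l t) t) (succ zero) == zero).
  { apply (@search_expressible (fun t k => dist (pre k t) (succ zero))); [solve_proper2|express|].
    intros t. oex (@length_exists G t) as k Hk. oexists k. rewrite Hk. apply dist_refl. }
  oex L as l Hl0. clear L.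
  assert (Hl : forall t, eqn G (pre (NApp l t) t) (succ zero)).
  { intros t. apply dist_eq0, Hl0. }
  clear Hl0.
  assert (E : expressible (fun p => witness a z l (fst p) (snd p))) by (unfold witness; express).
  oex (proj2 E G) as c Hc0. clear E.
  assert (Hc : forall s t, eqn G (NApp c (pair s t)) (witness a z l s t)).
  { intros s t. rewrite (Hc0 _ : eqn G _ _), fst_pair, snd_pair. reflexivity. }
  clear Hc0.
  assert (CA : G ||- oCA c zero).
  { refine (impE (BI c) _). split.
    - intros g. oex (bar_almost_finite (g := g) Ht Hz Hb Hab Hbar) as n H. oex H as t K. clear H.
      oexists n. oexists t. osplit; [apply K|]. exact (almost_finite_CA Hl Hc (proj2 K)).
    - intros s. split.
      + ointro H. intros i. apply (almost_finite_CA Hl Hc), almost_finite_push.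
        exact (CA_almost_finite Hl Hc H).
      + ointro H. apply (almost_finite_CA Hl Hc), (almost_finite_node Ht Hz Hb Hfan Hab).
        intros i. exact (CA_almost_finite Hl Hc (H i)). }
  apply (CA_almost_finite Hl Hc) in CA.
  (* Every term [z n] extends the empty sequence by all of its entries, so this [g] proposes [z n]
     itself at [n], and it can fail only by not being in the bar. *)
  assert (E : expressible (fun n => pair zero (NApp l (NApp z n)))) by express.
  oex (proj2 E G) as g Hg. clear E. oex (CA g) as n Hn. oexists n. ointro K.
  refine (impE Hn _). fold_eqn. rewrite (Hg n : eqn G _ _), fst_pair, snd_pair, add_0_r.
  exact (miss_0_intro K (Hl _)).
Qed.

Theorem theorem7p2 : BIM_proves (Imp Pi11_BI AlmFT).
Proof.
  rewrite <- (subst_id (Imp Pi11_BI AlmFT)). apply represents_sem.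
  change (nil ||- oPi11_BI -> oAlmFT). ointro H. exact (almost_fan H).
Qed.
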